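(* Let $\mathbb{K}$ be a field and for each partition diagram $\pi$ let $L_\pi:=\sum_{\sigma\le\pi}M_\sigma\in\mathrm{ParQSym}$. For all non-empty partition diagrams $\rho,\sigma$, $$L_\rho\star L_\sigma=\sum L_{(\rho_1\bullet\sigma_1)\otimes(\rho_2\bullet\sigma_2)\otimes\cdots\otimes(\rho_k\bullet\sigma_k)},$$ where the sum is over all $k\in\mathbb{N}$ and all pairs of sequences $(\rho_1,\dots,\rho_k)$, $(\sigma_1,\dots,\sigma_k)$ of (possibly $\otimes$-reducible, possibly empty) partition diagrams such that $\rho$ can be expressed as $\rho_1\divideontimes^\rho_1\cdots\divideontimes^\rho_{k-1}\rho_k$ and $\sigma$ can be expressed as $\sigma_1\divideontimes^\sigma_1\cdots\divideontimes^\sigma_{k-1}\sigma_k$ for some $\divideontimes^\rho_i,\divideontimes^\sigma_j\in\{\otimes,\bullet\}$, and such that $\sigma_1,\dots,\sigma_{k-1}$ and $\rho_2,\dots,\rho_k$ are non-empty (each such pair of sequences is counted once). Moreover $L_\rho\star L_\emptyset=L_\emptyset\star L_\rho=L_\rho$ for every partition diagram $\rho$.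
   Context: **Partition diagrams.** A partition diagram of order $k\ge 0$ is a set partition of $\{1,\dots,k,1',\dots,k'\}$; for $k=0$ the only one is the empty diagram $\emptyset$. For $\pi$ of order $k$ and $\rho$ of order $m$, $\pi\otimes\rho$ is the diagram of order $k+m$ whose blocks are the blocks of $\pi$ and the blocks of $\rho$ with labels shifted by $k$ ($i\mapsto i+k$, $i'\mapsto (i+k)'$). If $k,m\ge1$, $\pi\bullet\rho$ is obtained from $\pi\otimes\rho$ by merging the block containing $k'$ with the block containing $(k+1)'$. The empty diagram is the unit for both operations. A diagram is $\otimes$-irreducible (resp. $\bullet$-irreducible) if it is not $\rho\otimes\sigma$ (resp. $\rho\bullet\sigma$) with $\rho,\sigma$ both non-empty. Every non-empty $\pi$ is uniquely $\pi_1\otimes\cdots\otimes\pi_l$ with all $\pi_i$ non-empty and $\otimes$-irreducible. **Refinement.** Every non-empty $\pi$ can be uniquely written $\pi=\pi_1\divideontimes_1\pi_2\divideontimes_2\cdots\divideontimes_{n-1}\pi_n$ with each $\divideontimes_i\in\{\otimes,\bullet\}$ and each $\pi_i$ non-empty and both $\otimes$- and $\bullet$-irreducible (on non-empty diagrams $\otimes$ and $\bullet$ associate with each other, so no brackets are needed). Put $S(\pi)=\{i\in\{1,\dots,n-1\}:\divideontimes_i=\otimes\}$. For non-empty $\pi,\sigma$ write $\pi\sim\sigma$ if their sequences $(\pi_1,\dots,\pi_n)$ and $(\sigma_1,\dots,\sigma_m)$ are equal; $\pi\le\sigma$ ($\pi$ refines $\sigma$) if $\pi\sim\sigma$ and $S(\sigma)\subseteq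 S(\pi)$. The empty diagram is related only to itself, with $\emptyset\le\emptyset$. **Algebra ParQSym.** $\mathrm{ParQSym}$ is the $\mathbb{K}$-vector space with basis $\{M_\pi\}$ indexed by all partition diagrams, with product $\star$: $M_\emptyset$ is the unit, and for non-empty $\rho=\rho_1\otimes\cdots\otimes\rho_n$, $\sigma=\sigma_1\otimes\cdots\otimes\sigma_m$ with all $\rho_i,\sigma_j$ non-empty $\otimes$-irreducible, $$M_\rho\star M_\sigma=\sum M_{(\rho'_1\bullet\sigma'_1)\otimes\cdots\otimes(\rho'_k\bullet\sigma'_k)},$$ over all $k\in\mathbb{N}$ and all pairs of sequences of diagrams $(\rho'_1,\dots,\rho'_k)$, $(\sigma'_1,\dots,\sigma'_k)$ that become $(\rho_1,\dots,\rho_n)$, respectively $(\sigma_1,\dots,\sigma_m)$, after deleting all empty diagrams, and such that $\rho'_s\bullet\sigma'_s\ne\emptyset$ for all $1\le s\le k$. *)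

(* Defs.v *)
From HB Require Import structures.
From mathcomp Require Import all_boot all_order all_algebra.
From mathcomp Require Import finmap.
From mathcomp Require Import boolp classical_sets functions cardinality fsbigop.
From mathcomp Require Import monalg.

Set Implicit Arguments.
Unset Strict Implicit.
Unset Printing Implicit Defensive.

Import GRing.Theory.
Local Open Scope classical_set_scope.
Local Open Scope ring_scope.

(* In a diagram of order k, the label i is inl (i - 1) and the label i' is    *)
(* inr (i - 1).                                                               *)
Definition label (k : nat) : finType := ('I_k + 'I_k)%type.

Definition diag_of (k : nat) :=
  {P : {set {set label k}} | finset.partition P [set: label k]%SET}.
HB.instance Definition _ k := Finite.on (diag_of k).

Definition diagram := {k : nat & diag_of k}.
(* The derived instances are avoided on purpose: conversion tests such as     *)
(* << p >> =? << q >> in {malg K[diagram]} unfold them and diverge.           *)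
HB.instance Definition _ := gen_eqMixin diagram.
HB.instance Definition _ := gen_choiceMixin diagram.

Definition dorder (p : diagram) : nat := tag p.

Definition label_map k m (f : 'I_k -> 'I_m) (x : label k) : label m :=
  match x with inl i => inl (f i) | inr i => inr (f i) end.

Definition blocks_tens k m (P : {set {set label k}}) (Q : {set {set label m}}) :
    {set {set label (k + m)}} :=
  ([set label_map (@lshift k m) @: (B : {set _}) | B in P] :|:
   [set label_map (@rshift k m) @: (B : {set _}) | B in Q])%SET.

Definition blocks_merge (T : finType) (P : {set {set T}}) (x y : T) :
    {set {set T}} :=
  ((finset.pblock P x :|: finset.pblock P y)
     |: (P :\ finset.pblock P x :\ finset.pblock P y))%SET.

(* The merged blocks are those of k' and (k+1)', where k = a.+1.              *)
Definition blocks_bullet a b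
    (P : {set {set label a.+1}}) (Q : {set {set label b.+1}}) :
    {set {set label (a.+1 + b.+1)}} :=
  blocks_merge (blocks_tens P Q)
    (inr (lshift b.+1 ord_max)) (inr (rshift a.+1 ord0)).

Lemma label_map_inj k m (f : 'I_k -> 'I_m) :
  injective f -> injective (label_map f).
Proof. by move=> fI [x|x] [y|y] //= [/fI->]. Qed.

Lemma partition_tens k m (P : {set {set label k}}) (Q : {set {set label m}}) :
  finset.partition P [set: label k]%SET -> finset.partition Q [set: label m]%SET ->
  finset.partition (blocks_tens P Q) [set: label (k + m)]%SET.
Proof.
move=> hP hQ.
have lI : injective (label_map (@lshift k m)).
  by apply: label_map_inj; exact: lshift_inj.
have rI : injective (label_map (@rshift k m)).
  by apply: label_map_inj; exact: rshift_inj.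
have := hP; rewrite -(imset_partition P _ lI) => /and3P[/eqP cP tP nP].
have := hQ; rewrite -(imset_partition Q _ rI) => /and3P[/eqP cQ tQ nQ].
apply/and3P; split.
- rewrite /finset.cover finset.bigcup_setU; apply/eqP.
  rewrite -/(finset.cover _) -[X in (_ :|: X)%SET]/(finset.cover _) cP cQ.
  apply/setP => x; rewrite !inE.
  case: x => x; case: (splitP x) => j xj; apply/orP.
  + by left; apply/imsetP; exists (inl j) => //; congr inl; exact: val_inj.
  + by right; apply/imsetP; exists (inl j) => //; congr inl; exact: val_inj.
  + by left; apply/imsetP; exists (inr j) => //; congr inr; exact: val_inj.
  + by right; apply/imsetP; exists (inr j) => //; congr inr; exact: val_inj.
- rewrite trivIsetU // cP cQ -setI_eq0; apply/eqP/setP => x; rewrite !inE.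
  apply/negP => /andP[/imsetP[[i|i] _ ->] /imsetP[[j|j] _ //= []]] e;
  by have := ltn_ord i; rewrite e ltnNge leq_addr.
- by rewrite inE negb_or; apply/andP.
Qed.

Lemma partition_merge (T : finType) (P : {set {set T}}) (D : {set T}) (x y : T) :
  x \in D -> finset.partition P D -> finset.partition (blocks_merge P x y) D.
Proof.
move=> xD hP; have /and3P[/eqP cP tP nP] := hP.
set A := finset.pblock P x; set B := finset.pblock P y.
have AP : A \in P by apply: finset.pblock_mem; rewrite cP.
have xA : x \in A by rewrite mem_pblock cP.
have BP : B \in P \/ B = finset.set0.
  rewrite /B /finset.pblock; case: pickP => [C /andP[CP _]|_] /=; by [left|right].
have mem C : C \in P -> C != A -> C != B -> [disjoint (A :|: B)%SET & C]%B.
  move=> CP CA CB; rewrite -setI_eq0 finset.setIUl finset.setU_eq0 !setI_eq0.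
  apply/andP; split.
    by move/finset.trivIsetP: tP; apply => //; rewrite eq_sym.
  case: BP => [BP|->]; last by rewrite -setI_eq0 finset.set0I.
  by move/finset.trivIsetP: tP; apply => //; rewrite eq_sym.
apply/and3P; split.
- rewrite finset.eqEsubset; apply/andP; split.
    apply/finset.bigcupsP => C; rewrite !inE => /orP[/eqP->|/and3P[_ _ CP]].
      rewrite -/A -/B finset.subUset (finset.partitionS hP AP).
      by case: BP => [/(finset.partitionS hP) //|->]; exact: finset.sub0set.
    exact: (finset.partitionS hP).
  apply/fintype.subsetP => z; rewrite -cP => /finset.bigcupP[C CP zC].
  have [CA|CA] := eqVneq C A.
    by apply/finset.bigcupP; exists (A :|: B)%SET; rewrite !inE ?eqxx // -CA zC.
  have [CB|CB] := eqVneq C B.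
    by apply/finset.bigcupP; exists (A :|: B)%SET; rewrite !inE ?eqxx // -CB zC orbT.
  by apply/finset.bigcupP; exists C; rewrite // !inE CA CB CP !orbT.
- apply/finset.trivIsetP => C C'; rewrite !inE.
  move=> /orP[/eqP->|/and3P[CB CA CP]] /orP[/eqP->|/and3P[C'B C'A C'P]].
  + by rewrite eqxx.
  + by move=> _; exact: mem.
  + by move=> _; rewrite disjoint_sym; exact: mem.
  + by move/finset.trivIsetP: tP; apply.
- rewrite !inE negb_or (negbTE nP) !andbF andbT eq_sym.
  by apply/set0Pn; exists x; rewrite inE xA.
Qed.

Definition tens_of k m (P : diag_of k) (Q : diag_of m) : diag_of (k + m) :=
  exist _ (blocks_tens (sval P) (sval Q)) (partition_tens (svalP P) (svalP Q)).

Definition bullet_of a b (P : diag_of a.+1) (Q : diag_of b.+1) :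
    diag_of (a.+1 + b.+1) :=
  exist _ (blocks_bullet (sval P) (sval Q))
    (partition_merge _ (finset.in_setT _)
       (partition_tens (svalP P) (svalP Q))).

Lemma partition_empty :
  finset.partition (finset.set0 : {set {set label 0}}) [set: label 0]%SET.
Proof.
rewrite (_ : [set: label 0]%SET = finset.set0) ?partition_set0 //.
by apply/setP => -[[]|[]].
Qed.

Definition empty_diag : diagram :=
  existT diag_of 0%N (exist _ finset.set0 partition_empty).

Definition tens (p q : diagram) : diagram :=
  existT diag_of (dorder p + dorder q)%N (tens_of (tagged p) (tagged q)).

Definition bullet (p q : diagram) : diagram :=
  match p, q with
  | existT 0%N _, _ => q
  | _, existT 0%N _ => p
  | existT a.+1 P, existT b.+1 Q =>
      existT diag_of (a.+1 + b.+1)%N (bullet_of P Q)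
  end.

Definition tens_irreducible (p : diagram) : Prop :=
  ~ exists q r, [/\ q <> empty_diag, r <> empty_diag & p = tens q r].

Definition bullet_irreducible (p : diagram) : Prop :=
  ~ exists q r, [/\ q <> empty_diag, r <> empty_diag & p = bullet q r].

Definition tens_seq (s : seq diagram) : diagram := foldr tens empty_diag s.

Definition tens_factorization (p : diagram) (s : seq diagram) : Prop :=
  (forall d, d \in s -> d <> empty_diag /\ tens_irreducible d) /\ p = tens_seq s.

Inductive conn := Tens | Bullet.

Definition conn_op (c : conn) : diagram -> diagram -> diagram :=
  match c with Tens => tens | Bullet => bullet end.

(* s_1 c_1 (s_2 c_2 (... s_k)), meant for lists with size c = (size s).-1.    *)
Fixpoint mixed_prod (s : seq diagram) (c : seq conn) : diagram :=
  match s, c with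
  | d :: s', e :: c' => conn_op e d (mixed_prod s' c')
  | d :: _, [::] => d
  | [::], _ => empty_diag
  end.

Definition mixed_expression (p : diagram) (s : seq diagram) (c : seq conn) :
    Prop :=
  size c = (size s).-1 /\ p = mixed_prod s c.

Definition mixed_factorization (p : diagram) (s : seq diagram) (c : seq conn) :
    Prop :=
  (forall d, d \in s ->
     [/\ d <> empty_diag, tens_irreducible d & bullet_irreducible d])
  /\ mixed_expression p s c.

(* The set S(p); the connectives are indexed from 1.                          *)
Definition tens_positions (p : diagram) : set nat :=
  [set i | exists s c, [/\ mixed_factorization p s c,
     (0 < i < size s)%N & nth Bullet c i.-1 = Tens]].

Definition same_factors (p q : diagram) : Prop :=
  exists s c c', mixed_factorization p s c /\ mixed_factorization q s c'.

Definition refines (p q : diagram) : Prop :=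
  (p = empty_diag /\ q = empty_diag) \/
  [/\ p <> empty_diag, q <> empty_diag, same_factors p q
    & tens_positions q `<=` tens_positions p].

Definition bullet_zip (t : seq diagram * seq diagram) : seq diagram :=
  [seq bullet d.1 d.2 | d <- zip t.1 t.2].

Definition quasi_shuffles (p q : diagram) : set (seq diagram * seq diagram) :=
  [set t | [/\ size t.1 = size t.2,
               tens_factorization p [seq d <- t.1 | d != empty_diag],
               tens_factorization q [seq d <- t.2 | d != empty_diag]
             & forall d, d \in bullet_zip t -> d <> empty_diag]].

Definition splittings (p q : diagram) : set (seq diagram * seq diagram) :=
  [set t | [/\ size t.1 = size t.2,
               exists c, mixed_expression p t.1 c,
               exists c, mixed_expression q t.2 c,
               forall i, (i < (size t.2).-1)%N -> nth empty_diag t.2 i <> empty_diag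
             & forall i, (0 < i < size t.1)%N -> nth empty_diag t.1 i <> empty_diag]].

(* \sum_(x \in A) F x is 0 by convention when F has infinite support on A;     *)
(* finite_refines, finite_quasi_shuffles and finite_splittings show that this *)
(* never happens in the sums below.                                           *)
Lemma dorder_eq0 (p : diagram) : dorder p = 0%N -> p = empty_diag.
Proof.
case: p => k P /= k0; rewrite /dorder /= in k0; subst k.
congr existT; apply/val_inj/setP => B /=; rewrite finset.in_set0.
apply/negbTE/negP => BP; have := partition_neq0 (svalP P) BP.
by case/set0Pn => -[[]|[]].
Qed.

Lemma dorder_gt0 (p : diagram) : p <> empty_diag -> (0 < dorder p)%N.
Proof. by move=> p0; rewrite lt0n; apply/eqP => /dorder_eq0. Qed.

Lemma dorder_bullet p q : dorder (bullet p q) = (dorder p + dorder q)%N.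
Proof.
by case: p q => -[|a] P [[|b] Q]; rewrite /dorder //= addn0.
Qed.

Lemma dorder_conn c p q : dorder (conn_op c p q) = (dorder p + dorder q)%N.
Proof. by case: c => //; exact: dorder_bullet. Qed.

Lemma dorder_tens_seq s : dorder (tens_seq s) = sumn (map dorder s).
Proof. by elim: s => //= d s <-. Qed.

Lemma dorder_mixed_expression p s c :
  mixed_expression p s c -> dorder p = sumn (map dorder s).
Proof.
case=> + ->; elim: s c => [|d s IH] [|e c] //=.
  by case: s {IH} => //=; rewrite addn0.
by rewrite dorder_conn; case: s IH => //= d' s IH [/IH ->].
Qed.

Lemma finite_diagrams n : finite_set [set p : diagram | (dorder p <= n)%N].
Proof.
have -> : [set p : diagram | (dorder p <= n)%N] =
    \bigcup_(k in `I_n.+1) (existT diag_of k @` [set: diag_of k]).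
  apply/seteqP; split => [[k P] /= kn|_ [k kn [P _ <-]]//].
  by exists k => //; exists P.
by apply: bigcup_finite => // k _; exact/finite_image/finite_finset.
Qed.

Lemma finite_seqs (T : choiceType) (A : set T) n : finite_set A ->
  finite_set [set s : seq T | (size s <= n)%N /\ forall x, x \in s -> A x].
Proof.
move=> fA; elim: n => [|n IH].
  by apply: (@sub_finite_set _ _ [set [::]]) => // -[|? ?] [].
set B := [set s | _] in IH.
apply: (@sub_finite_set _ _ ([set [::]] `|` [set x :: s | x in A & s in B])).
  move=> -[|x s] [ss As]; [by left|right].
  exists x; first by apply: As; rewrite mem_head.
  by exists s => //; split=> // y ys; apply: As; rewrite in_cons ys orbT.
by rewrite finite_setU; split => //; exact: finite_image2.
Qed.

Lemma dorder_refines p q : refines p q -> dorder p = dorder q.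
Proof.
case=> [[-> ->]//|[_ _ [s [c [c' [[_ ep] [_ eq]]]]] _]].
by rewrite (dorder_mixed_expression ep) (dorder_mixed_expression eq).
Qed.

Lemma finite_refines p : finite_set [set q | refines q p].
Proof.
apply: sub_finite_set (finite_diagrams (dorder p)) => q /= /dorder_refines ->.
exact: leqnn.
Qed.

Lemma mem_sumn_le (s : seq diagram) d :
  d \in s -> (dorder d <= sumn (map dorder s))%N.
Proof.
elim: s => //= e s IH; rewrite in_cons => /orP[/eqP->|/IH le_d].
  exact: leq_addr.
exact: leq_trans le_d (leq_addl _ _).
Qed.

Lemma size_le_sumn (s : seq diagram) :
  (forall d, d \in s -> d <> empty_diag) ->
  (size s <= sumn (map dorder s))%N.
Proof.
elim: s => //= d s IH s0; rewrite -add1n leq_add //.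
  by apply/dorder_gt0/s0; rewrite mem_head.
by apply: IH => e es; apply: s0; rewrite in_cons es orbT.
Qed.

Lemma finite_seq_pairs n :
  finite_set [set t : seq diagram * seq diagram |
    [/\ size t.1 = size t.2, (size t.1 <= n)%N,
        (sumn (map dorder t.1) <= n)%N & (sumn (map dorder t.2) <= n)%N]].
Proof.
set B := [set s : seq diagram |
  (size s <= n)%N /\ forall d, d \in s -> [set p | (dorder p <= n)%N] d].
have fB : finite_set B := finite_seqs n (finite_diagrams n).
apply: sub_finite_set (finite_setX fB fB) => -[r s] /= [rs sr rn sn].
have rle d : d \in r -> (dorder d <= n)%N.
  by move=> /mem_sumn_le dn; exact: leq_trans dn rn.
have sle d : d \in s -> (dorder d <= n)%N.
  by move=> /mem_sumn_le dn; exact: leq_trans dn sn.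
by split; split => //=; rewrite -rs.
Qed.

Lemma sumn_filter_empty (s : seq diagram) :
  sumn (map dorder [seq d <- s | d != empty_diag]) = sumn (map dorder s).
Proof. by elim: s => //= d s <-; case: eqVneq => // ->. Qed.

Lemma sumn_bullet_zip (t : seq diagram * seq diagram) :
  size t.1 = size t.2 -> sumn (map dorder (bullet_zip t)) =
    (sumn (map dorder t.1) + sumn (map dorder t.2))%N.
Proof.
case: t => r s /=; rewrite /bullet_zip /=.
elim: r s => [|d r IH] [|e s] //= [/IH ->].
by rewrite dorder_bullet addnACA.
Qed.

Lemma finite_quasi_shuffles p q : finite_set (quasi_shuffles p q).
Proof.
apply: sub_finite_set (finite_seq_pairs (dorder p + dorder q)) => t.
move=> [st [_ ->] [_ ->] /size_le_sumn].
rewrite sumn_bullet_zip // size_map size_zip -st minnn.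
by rewrite !dorder_tens_seq !sumn_filter_empty => le_s; split;
  rewrite // (leq_addr, leq_addl).
Qed.

Lemma finite_splittings p q : finite_set (splittings p q).
Proof.
apply: sub_finite_set (finite_seq_pairs (dorder p + dorder q).+1).
move=> -[r s] /= [rs [c /dorder_mixed_expression ->]].
move=> [c' /dorder_mixed_expression ->] _ r0; split=> //.
- have: (size (behead r) <= sumn (map dorder (behead r)))%N.
    apply: size_le_sumn => d /(nthP empty_diag)[i].
    by rewrite size_behead nth_behead ltn_predRL => ir <-; exact: r0.
  case: r {rs r0} => //= d r le_r.
  by rewrite ltnS (leq_trans le_r) // -addnA addnCA leq_addr.
- exact: leq_trans (leq_addr _ _) (leqnSn _).
- exact: leq_trans (leq_addl _ _) (leqnSn _).
Qed.

Definition ParQSym (K : fieldType) := {malg K[diagram]}.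
HB.instance Definition _ K := GRing.Lmodule.on (ParQSym K).

Definition M (K : fieldType) (p : diagram) : ParQSym K := << p >>.

Definition starM (K : fieldType) (p q : diagram) : ParQSym K :=
  if p == empty_diag then M K q else if q == empty_diag then M K p
  else \sum_(t \in quasi_shuffles p q) M K (tens_seq (bullet_zip t)).

Definition star (K : fieldType) (f g : ParQSym K) : ParQSym K :=
  \sum_(p <- msupp f) \sum_(q <- msupp g) (f@_p * g@_q) *: starM K p q.

Lemma starMM (K : fieldType) (p q : diagram) :
  star (M K p) (M K q) = starM K p q.
Proof.
have sM d : msupp (M K d) = [fset d]%fset by rewrite msuppU oner_eq0.
rewrite /star !sM big_seq_fset1 big_seq_fset1.
by rewrite !mcoeffUU mulr1 scale1r.
Qed.

Definition L (K : fieldType) (p : diagram) : ParQSym K :=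
  \sum_(q \in [set q | refines q p]) M K q.

(* Main.v *)
(* Every non-empty diagram is uniquely an alternating product of irreducible
   diagrams (letters) and connectives: on codes, a factorization at position j
   is a property of the block relation across j, which yields both mixed
   associativity and a Levi-type lemma. So M_p * M_q and L_p * L_q can be
   compared by induction on letters.

   Let a be a letter, and let <. (resp. .>) denote the part of a product in
   which the first letter comes from the left (resp. right) factor. Writing T_a
   and B_a for M_d -> M_(a (x) d) and M_d -> M_(a . d), one has
     L_(a (x) r) = T_a L_r,   L_(a . r) = (T_a + B_a) L_r,
     (T_a P) <. Q = T_a (P * Q) + B_a (P .> Q),   (B_a P) <. Q = B_a (P <. Q),
     P .> (T_b Q) = T_b (P * Q),                  P .> (B_b Q) = B_b (P .> Q).
   Splitting pairs of sequences according to whether the first diagram is empty,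
   and removing the first letter, gives the same recursion for the right-hand
   side. Instead of the operators T_a and B_a, an arbitrary function F on
   diagrams replaces M, so that T_a and B_a become precompositions. *)
Require Import Defs.
From HB Require Import structures.
From mathcomp Require Import all_boot all_order all_algebra.
From mathcomp Require Import finmap.
From mathcomp Require Import boolp classical_sets functions cardinality fsbigop.
From mathcomp Require Import monalg.
From mathcomp Require Import zify.

Local Open Scope ring_scope.

Set Implicit Arguments.
Unset Strict Implicit.

(** * Diagrams as equivalence relations on codes *)

Section Relations.
Local Open Scope nat_scope.

(* Codes do not depend on the order, so that diagrams of orders which are only
   propositionally equal can be compared through relations on codes. *)
Definition code k (l : label k) : bool * nat :=
  match l with inl i => (false, val i) | inr i => (true, val i) end.

Lemma code_inj k : injective (@code k).
Proof. by move=> [i|i] [j|j] //= [] /val_inj ->. Qed.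

Lemma codeP k s i : i < k -> exists l : label k, code l = (s, i).
Proof.
move=> ik; case: s; [by exists (inr (Ordinal ik))|by exists (inl (Ordinal ik))].
Qed.

Lemma code_lt k (l : label k) : (code l).2 < k.
Proof. by case: l => i /=. Qed.

(** Total on all pairs of codes: a code out of range is related to nothing, itself included. *)
Definition eqv (p : diagram) (x y : bool * nat) : bool :=
  [exists l : label (dorder p), exists l' : label (dorder p),
    [&& code l == x, code l' == y & l' \in finset.pblock (sval (tagged p)) l]].

Lemma eqv_code k (P : diag_of k) (l l' : label k) :
  eqv (existT diag_of k P) (code l) (code l') = (l' \in finset.pblock (sval P) l).
Proof.
apply/existsP/idP => [[a /existsP[b /and3P[/eqP/code_inj-> /eqP/code_inj->]]]//|].
by move=> ll'; exists l; apply/existsP; exists l'; rewrite !eqxx.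
Qed.

Lemma diag_cover k (P : diag_of k) l : l \in finset.cover (sval P).
Proof. by have /and3P[/eqP-> _ _] := svalP P; rewrite finset.in_setT. Qed.

Lemma diag_triv k (P : diag_of k) : finset.trivIset (sval P).
Proof. by have /and3P[] := svalP P. Qed.

Lemma eqv_lt p x y : eqv p x y -> (x.2 < dorder p) && (y.2 < dorder p).
Proof.
case/existsP=> l /existsP[l' /and3P[/eqP<- /eqP<- _]].
by rewrite !code_lt.
Qed.

Lemma eqv_refl p x : eqv p x x = (x.2 < dorder p).
Proof.
apply/idP/idP => [/eqv_lt/andP[]//|]; case: x => s i /= ik.
have [l <-] := codeP s ik; case: p l {ik} => k P l.
by rewrite eqv_code finset.mem_pblock; exact: (diag_cover P).
Qed.

Lemma eqv_sym p x y : eqv p x y = eqv p y x.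
Proof.
suff H u v : eqv p u v -> eqv p v u by apply/idP/idP; exact: H.
case: p => k P /existsP[l /existsP[l' /and3P[/eqP<- /eqP<- ll']]].
rewrite eqv_code; suff <- : finset.pblock (sval P) l = finset.pblock (sval P) l'.
  by rewrite finset.mem_pblock; exact: (diag_cover P).
apply/esym; exact: finset.same_pblock (diag_triv P) ll'.
Qed.

Lemma eqv_trans p y x z : eqv p x y -> eqv p y z -> eqv p x z.
Proof.
case: p => k P /existsP[l /existsP[l' /and3P[/eqP<- /eqP<- ll']]].
case/existsP=> [m /existsP[m' /and3P[/eqP/code_inj e /eqP<- mm']]].
subst m; rewrite eqv_code.
by rewrite -(finset.same_pblock (diag_triv P) ll').
Qed.

(** Once the orders are identified, each partition is recovered as the set of classes of its own
    [pblock] relation, which is what [eqv] records. *)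
Lemma diagram_ext p q : dorder p = dorder q ->
  (forall s i t j, i < dorder p -> j < dorder p ->
     eqv p (s, i) (t, j) = eqv q (s, i) (t, j)) ->
  p = q.
Proof.
case: p q => k P [m Q] /= km; rewrite /dorder /= in km *; subst m => H.
congr existT; apply/val_inj => /=.
rewrite -(equivalence_partition_pblock (svalP P)).
rewrite -(equivalence_partition_pblock (svalP Q)).
apply: eq_in_imset => l _; apply/finset.setP => l'; rewrite !finset.inE /=.
move: (H (code l).1 (code l).2 (code l').1 (code l').2 (code_lt l) (code_lt l')).
by rewrite -!surjective_pairing !eqv_code.
Qed.

(** Supplies the middle factor in the Levi-type lemma, where only its block relation is known
    beforehand. *)
Lemma diagram_of_rel k (R : rel (bool * nat)) :
  (forall x, x.2 < k -> R x x) ->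
  (forall x y, R x y = R y x) ->
  (forall y x z, R x y -> R y z -> R x z) ->
  exists p, dorder p = k /\
    forall s i t j, i < k -> j < k -> eqv p (s, i) (t, j) = R (s, i) (t, j).
Proof.
move=> Rxx Rs Rt; pose R' (l l' : label k) := R (code l) (code l').
have eR : {in [set: label k] & &, equivalence_rel R'}%SET.
  move=> x y z _ _ _; split; first exact/Rxx/code_lt.
  move=> xy; apply/idP/idP; last exact: Rt.
  by apply: Rt; rewrite Rs.
pose P : diag_of k :=
  exist _ (equivalence_partition R' [set: label k]%SET) (equivalence_partitionP eR).
exists (existT diag_of k P); split=> // s i t j ik jk.
have [l <-] := codeP s ik; have [l' <-] := codeP t jk.
by rewrite eqv_code /= pblock_equivalence_partition ?finset.in_setT.
Qed.

(** * Block relations of the two products *)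

Lemma code_lshift k m (l : label k) : code (label_map (@lshift k m) l) = code l.
Proof. by case: l. Qed.

Lemma code_rshift k m (l : label m) :
  code (label_map (@rshift k m) l) = ((code l).1, k + (code l).2).
Proof. by case: l. Qed.

Lemma label_lshift_inj k m : injective (label_map (@lshift k m)).
Proof. by apply: label_map_inj; exact: lshift_inj. Qed.

Lemma label_rshift_inj k m : injective (label_map (@rshift k m)).
Proof. by apply: label_map_inj; exact: rshift_inj. Qed.

Lemma pblock_tens_l k m (P : diag_of k) (Q : diag_of m) (l : label k) :
  finset.pblock (blocks_tens (sval P) (sval Q)) (label_map (@lshift k m) l) =
  (label_map (@lshift k m) @: finset.pblock (sval P) l)%SET.
Proof.
have lc := diag_cover P l.
apply: def_pblock; first exact: (diag_triv (tens_of P Q)).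
  rewrite finset.in_setU; apply/orP; left; apply: imset_f; exact: finset.pblock_mem.
by apply: imset_f; rewrite finset.mem_pblock.
Qed.

Lemma pblock_tens_r k m (P : diag_of k) (Q : diag_of m) (l : label m) :
  finset.pblock (blocks_tens (sval P) (sval Q)) (label_map (@rshift k m) l) =
  (label_map (@rshift k m) @: finset.pblock (sval Q) l)%SET.
Proof.
have lc := diag_cover Q l.
apply: def_pblock; first exact: (diag_triv (tens_of P Q)).
  rewrite finset.in_setU; apply/orP; right; apply: imset_f; exact: finset.pblock_mem.
by apply: imset_f; rewrite finset.mem_pblock.
Qed.

Lemma rshift_lshift_notin k m (l : label m) (A : {set label k}) :
  (label_map (@rshift k m) l \in (label_map (@lshift k m) @: A)%SET) = false.
Proof.
apply/negP => /imsetP[l' _ /(congr1 (@code _))].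
rewrite code_lshift code_rshift => /(congr1 snd) /= e.
by have := code_lt l'; rewrite -e ltnNge leq_addr.
Qed.

(** Merging yields a partition again, so it is enough to exhibit one of its blocks that contains
    [z]. *)
Lemma pblock_merge (T : finType) (P : {set {set T}}) x y z :
  finset.partition P [set: T]%SET ->
  finset.pblock (blocks_merge P x y) z =
  if (z \in finset.pblock P x) || (z \in finset.pblock P y)
  then (finset.pblock P x :|: finset.pblock P y)%SET else finset.pblock P z.
Proof.
move=> hP; have /and3P[_ tM _] := partition_merge y (finset.in_setT x) hP.
have /and3P[/eqP cP tP _] := hP.
have zz u : u \in finset.pblock P u by rewrite finset.mem_pblock cP finset.in_setT.
have pm u : finset.pblock P u \in P.
  by apply: finset.pblock_mem; rewrite cP finset.in_setT.
apply: def_pblock => //; case: ifPn => h; rewrite ?finset.inE ?eqxx //.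
move: h; rewrite negb_or => /andP[h1 h2]; apply/orP; right; rewrite pm andbT.
apply/andP; split; [apply: contraNneq h2|apply: contraNneq h1] => <-; exact: zz.
Qed.

Lemma eqv_tens p q :
  [/\ forall s i t j, i < dorder p -> j < dorder p ->
        eqv (tens p q) (s, i) (t, j) = eqv p (s, i) (t, j),
      forall s i t j, i < dorder q -> j < dorder q ->
        eqv (tens p q) (s, dorder p + i) (t, dorder p + j) = eqv q (s, i) (t, j)
    & forall s i t j, i < dorder p -> j < dorder q ->
        eqv (tens p q) (s, i) (t, dorder p + j) = false].
Proof.
case: p q => [k P] [m Q]; rewrite /dorder /=.
split=> s i t j ik jk; have [l el] := codeP s ik; have [l' el'] := codeP t jk.
- rewrite -el -el' -(code_lshift m l) -(code_lshift m l') !eqv_code /=.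
  by rewrite pblock_tens_l mem_imset ?code_lshift ?eqv_code //; exact: label_lshift_inj.
- have -> : (s, k + i) = code (label_map (@rshift k m) l) by rewrite code_rshift el.
  have -> : (t, k + j) = code (label_map (@rshift k m) l') by rewrite code_rshift el'.
  rewrite -el -el' !eqv_code /=.
  by rewrite pblock_tens_r mem_imset //; exact: label_rshift_inj.
- have -> : (t, k + j) = code (label_map (@rshift k m) l') by rewrite code_rshift el'.
  by rewrite -el -(code_lshift m) eqv_code /= pblock_tens_l rshift_lshift_notin.
Qed.

(** The codes [(true, (dorder p).-1)] and [(true, dorder p)] are the two primed labels whose blocks
    are merged. *)
Lemma eqv_bullet p q s i t j :
  0 < dorder p -> 0 < dorder q ->
  i < dorder p + dorder q -> j < dorder p + dorder q ->
  eqv (bullet p q) (s, i) (t, j) =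
  if eqv (tens p q) (true, (dorder p).-1) (s, i) ||
     eqv (tens p q) (true, dorder p) (s, i)
  then eqv (tens p q) (true, (dorder p).-1) (t, j) ||
       eqv (tens p q) (true, dorder p) (t, j)
  else eqv (tens p q) (s, i) (t, j).
Proof.
case: p q => [[|a] P] [[|b] Q] //; rewrite /dorder => /= _ _ ik jk.
have [l <-] := codeP s ik; have [l' <-] := codeP t jk.
rewrite eqv_code /=.
rewrite pblock_merge; last exact: (svalP (tens_of P Q)).
rewrite /tens /=.
have -> : (true, a) = code (inr (lshift b.+1 ord_max) : label (a.+1 + b.+1)) by [].
have -> : (true, a.+1) = code (inr (rshift a.+1 ord0) : label (a.+1 + b.+1)).
  by rewrite /= addn0.
rewrite !eqv_code /=.
by case: ifP => _ //; rewrite finset.in_setU.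
Qed.

Definition is_bullet (e : conn) : bool := if e is Bullet then true else false.

Section Conn.
Variables (e : conn) (p q : diagram).
Hypotheses (p0 : 0 < dorder p) (q0 : 0 < dorder q).

Let pr : (dorder p).-1 < dorder p. Proof. by rewrite prednK. Qed.

Lemma eqv_conn_ll s i t j : i < dorder p -> j < dorder p ->
  eqv (conn_op e p q) (s, i) (t, j) = eqv p (s, i) (t, j).
Proof.
have [ll rr lr] := eqv_tens p q; case: e => /= ik jk; first exact: ll.
rewrite eqv_bullet ?ltn_addr //.
have rl u n : n < dorder p -> eqv (tens p q) (true, dorder p) (u, n) = false.
  by move=> np; rewrite eqv_sym -[X in (true, X)]addn0 lr.
rewrite !rl // !ll // !orbF; case: ifP => // h.
by apply/idP/idP; apply: eqv_trans => //; rewrite eqv_sym.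
Qed.

Lemma eqv_conn_rr s i t j : i < dorder q -> j < dorder q ->
  eqv (conn_op e p q) (s, dorder p + i) (t, dorder p + j) = eqv q (s, i) (t, j).
Proof.
have [ll rr lr] := eqv_tens p q; case: e => /= ik jk; first exact: rr.
rewrite eqv_bullet ?ltn_add2l //.
have e0 u : (u, dorder p) = (u, dorder p + 0) by rewrite addn0.
rewrite e0 !rr // !lr //=.
by case: ifP => // h; apply/idP/idP; apply: eqv_trans => //; rewrite eqv_sym.
Qed.

(** The only link across the junction is the merging of the blocks of the last primed label of [p]
    and the first primed label of [q], and only [Bullet] performs it. *)
Lemma eqv_conn_lr s i t j : i < dorder p -> j < dorder q ->
  eqv (conn_op e p q) (s, i) (t, dorder p + j) =
  [&& is_bullet e, eqv p (s, i) (true, (dorder p).-1) & eqv q (true, 0) (t, j)].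
Proof.
have [ll rr lr] := eqv_tens p q; case: e => /= ik jk; first exact: lr.
rewrite eqv_bullet ?ltn_add2l ?ltn_addr //.
have e0 u : (u, dorder p) = (u, dorder p + 0) by rewrite addn0.
rewrite e0 (lr true _ t) // (lr s) // rr // ll // eqv_sym.
rewrite [eqv _ (true, _ + 0) _]eqv_sym lr // orbF /=.
by case: ifP.
Qed.

End Conn.

(** * Unit laws, associativity and cancellation *)

Lemma empty_or p : p = empty_diag \/ 0 < dorder p.
Proof.
by case: (posnP (dorder p)) => [/dorder_eq0|]; [left|right].
Qed.

Lemma dorder_empty : dorder empty_diag = 0.
Proof. by []. Qed.

Lemma tens0d p : tens empty_diag p = p.
Proof.
apply: diagram_ext => // s i t j ik jk.
by have [_ rr _] := eqv_tens empty_diag p; exact: rr.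
Qed.

Lemma tensd0 p : tens p empty_diag = p.
Proof.
apply: diagram_ext => [|s i t j ik jk]; first exact: addn0.
rewrite [dorder _]addn0 in ik jk.
by have [ll _ _] := eqv_tens p empty_diag; exact: ll.
Qed.

Lemma bullet0d p : bullet empty_diag p = p.
Proof. by []. Qed.

Lemma bulletd0 p : bullet p empty_diag = p.
Proof. by case: p => [[|k] P] //=; apply/esym/dorder_eq0. Qed.

Lemma connd0 e p : conn_op e p empty_diag = p.
Proof. by case: e; [exact: tensd0|exact: bulletd0]. Qed.

Lemma conn0d e p : conn_op e empty_diag p = p.
Proof. by case: e => //; exact: tens0d. Qed.

(** Symmetry exchanges the two mixed cases of a cut at [a]. The relations are arbitrary, which
    allows a second cut inside a translated range. *)
Lemma eqv_cases (R : rel (bool * nat)) (R' : rel (bool * nat)) a b :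
  (forall x y, R x y = R y x) -> (forall x y, R' x y = R' y x) ->
  (forall s i t j, i < a -> j < a -> R (s, i) (t, j) = R' (s, i) (t, j)) ->
  (forall s i t j, i < b -> j < b ->
     R (s, a + i) (t, a + j) = R' (s, a + i) (t, a + j)) ->
  (forall s i t j, i < a -> j < b -> R (s, i) (t, a + j) = R' (s, i) (t, a + j)) ->
  forall s i t j, i < a + b -> j < a + b -> R (s, i) (t, j) = R' (s, i) (t, j).
Proof.
move=> Rs R's ll rr lr s i t j; case: (ltnP i a) => ia; case: (ltnP j a) => ja ib jb.
- exact: ll.
- by rewrite -(subnKC ja) lr // ltn_subLR.
- by rewrite Rs R's -(subnKC ia) lr // ltn_subLR.
- by rewrite -(subnKC ia) -(subnKC ja) rr // ltn_subLR.
Qed.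

(** Both sides induce the same relation on each pair of ranges. For empty [q] they would be
    [conn_op e' p r] and [conn_op e p r]. *)
Lemma conn_opA e e' p q r : q <> empty_diag ->
  conn_op e' (conn_op e p q) r = conn_op e p (conn_op e' q r).
Proof.
move=> /dorder_gt0 q0.
have [->|p0] := empty_or p; first by rewrite !conn0d.
have [->|r0] := empty_or r; first by rewrite !connd0.
have pq0 : 0 < dorder (conn_op e p q) by rewrite dorder_conn; lia.
have qr0 : 0 < dorder (conn_op e' q r) by rewrite dorder_conn; lia.
have qr0' : 0 < dorder q + dorder r by lia.
have pq0' : 0 < dorder p + dorder q by lia.
apply: diagram_ext; first by rewrite !dorder_conn addnA.
rewrite !dorder_conn -addnA.
apply: eqv_cases => [x y|x y|s i t j ip jp|s i t j|s i t j ip].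
- exact: eqv_sym.
- exact: eqv_sym.
- rewrite !eqv_conn_ll ?dorder_conn //; exact: ltn_addr.
(* Both codes lie beyond [p]; after translation by its order, a second cut separates [q] from
   [r]. *)
- move: s i t j.
  apply: (eqv_cases (R := fun x y => eqv _ (x.1, _ + x.2) (y.1, _ + y.2))
    (R' := fun x y => eqv _ (x.1, _ + x.2) (y.1, _ + y.2))) => /=.
  + move=> x y; exact: eqv_sym.
  + move=> x y; exact: eqv_sym.
  + move=> s i t j iq jq; rewrite eqv_conn_ll ?dorder_conn ?ltn_add2l //.
    rewrite !eqv_conn_rr // ?dorder_conn ?eqv_conn_ll //; exact: ltn_addr.
  + move=> s i t j ir jr; rewrite !addnA -(dorder_conn e p q) eqv_conn_rr //.
    by rewrite dorder_conn -!addnA !eqv_conn_rr // dorder_conn ltn_add2l.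
  + move=> s i t j iq jr; rewrite !addnA -(dorder_conn e p q) eqv_conn_lr //; last first.
      by rewrite dorder_conn ltn_add2l.
    rewrite dorder_conn -!addnA eqv_conn_rr ?dorder_conn ?ltn_add2l //; last exact: ltn_addr.
    rewrite eqv_conn_lr //.
    have -> : (dorder p + dorder q).-1 = dorder p + (dorder q).-1 by lia.
    rewrite eqv_conn_rr //; lia.
(* A code of [p] against one of [q] or [r]. In the latter case both junctions are crossed: both
   connectives must be [Bullet], and [q] must relate its first and last primed labels. *)
- case: (ltnP j (dorder q)) => [jq _|jq jr].
    rewrite eqv_conn_ll ?dorder_conn ?ltn_add2l //; last exact: ltn_addr.
    by rewrite !eqv_conn_lr ?dorder_conn ?eqv_conn_ll //; exact: ltn_addr.
  have [j' ej j'r] : exists2 j', j = dorder q + j' & j' < dorder r.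
    by exists (j - dorder q); lia.
  rewrite ej addnA -(dorder_conn e p q) eqv_conn_lr //; last by rewrite dorder_conn; lia.
  rewrite dorder_conn -addnA [in RHS]eqv_conn_lr ?dorder_conn ?ltn_add2l //.
  rewrite (eqv_conn_lr e') //.
  have -> : (dorder p + dorder q).-1 = dorder p + (dorder q).-1 by lia.
  rewrite eqv_conn_lr //; last by lia.
  by case: (is_bullet e); rewrite /= ?andbF // -!andbA; bool_congr.
Qed.

(** Both cuts are visible in the same diagram: the part between them is the middle factor, and the
    relations across its two ends are read off from the equation. *)
Lemma conn_op_levi e e' q r q' r' :
  q <> empty_diag -> r <> empty_diag -> q' <> empty_diag -> r' <> empty_diag ->
  conn_op e q r = conn_op e' q' r' -> dorder q < dorder q' ->
  exists2 m, m <> empty_diag & q' = conn_op e q m /\ r = conn_op e' m r'.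
Proof.
move=> /dorder_gt0 q0 /dorder_gt0 r0 /dorder_gt0 q'0 /dorder_gt0 r'0 E qq'.
have dE : dorder q + dorder r = dorder q' + dorder r'.
  by rewrite -(dorder_conn e) -(dorder_conn e') E.
have [n nE n0] : exists2 n, dorder q' = dorder q + n & 0 < n.
  by exists (dorder q' - dorder q); lia.
have rE : dorder r = n + dorder r' by lia.
(* The block relation of [q'] beyond the labels of [q], with indices shifted to start at 0. *)
pose R x y := eqv q' (x.1, dorder q + x.2) (y.1, dorder q + y.2).
have [m [dm mE]] : exists p, dorder p = n /\
    forall s i t j, i < n -> j < n -> eqv p (s, i) (t, j) =
      eqv q' (s, dorder q + i) (t, dorder q + j).
  apply: (@diagram_of_rel n R) => [x xn|x y|y x z]; rewrite /R.
  - by rewrite eqv_refl nE ltn_add2l.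
  - exact: eqv_sym.
  - exact: eqv_trans.
have m0 : 0 < dorder m by rewrite dm.
have qn0 : 0 < dorder q + n by lia.
exists m; first by move=> m0'; rewrite m0' in m0.
split; apply: diagram_ext; rewrite ?dorder_conn ?dm //.
- rewrite nE; apply: eqv_cases => [x y|x y|s i t j ip jp|s i t j ip jp|s i t j ip jp];
    try exact: eqv_sym.
  + rewrite eqv_conn_ll // -(eqv_conn_ll e' q'0 r'0) ?nE; try exact: ltn_addr.
    by rewrite -E eqv_conn_ll.
  + by rewrite eqv_conn_rr ?dm // mE.
  + rewrite eqv_conn_lr ?dm // mE // -(eqv_conn_ll e' q'0 r'0) ?nE ?ltn_add2l //;
      last exact: ltn_addr.
    rewrite -(eqv_conn_ll e' q'0 r'0) ?nE ?ltn_add2l // -E.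
    rewrite eqv_conn_lr //; last by lia.
    by rewrite eqv_conn_rr //; lia.
- rewrite rE; apply: eqv_cases => [x y|x y|s i t j ip jp|s i t j ip jp|s i t j ip jp];
    try exact: eqv_sym.
  + rewrite eqv_conn_ll ?dm // mE // -(eqv_conn_ll e' q'0 r'0) ?nE ?ltn_add2l //.
    by rewrite -E eqv_conn_rr // rE; exact: ltn_addr.
  + rewrite -{3 4}dm eqv_conn_rr ?dm // -(eqv_conn_rr e q0 r0) ?rE ?ltn_add2l //.
    by rewrite !addnA E -nE eqv_conn_rr.
  + rewrite -{2}dm eqv_conn_lr ?dm // -(eqv_conn_rr e q0 r0) ?rE ?ltn_add2l //;
      last exact: ltn_addr.
    rewrite addnA E -nE eqv_conn_lr ?nE ?ltn_add2l // mE //; last by lia.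
    by have -> : (dorder q + n).-1 = dorder q + n.-1 by lia.
Qed.

(** The factors are the restrictions of the relation to the two sides of the cut, and the connective
    is [Bullet] exactly when the primed labels next to the cut are related. *)
Lemma conn_op_inj e e' q r q' r' :
  q <> empty_diag -> r <> empty_diag -> q' <> empty_diag -> r' <> empty_diag ->
  conn_op e q r = conn_op e' q' r' -> dorder q = dorder q' ->
  [/\ e = e', q = q' & r = r'].
Proof.
move=> /dorder_gt0 q0 /dorder_gt0 r0 /dorder_gt0 q'0 /dorder_gt0 r'0 E qq'.
have dE : dorder q + dorder r = dorder q' + dorder r'.
  by rewrite -(dorder_conn e) -(dorder_conn e') E.
have rr' : dorder r = dorder r' by lia.
split.
- have : is_bullet e = is_bullet e'.
    have := eqv_conn_lr e q0 r0 true true (j := 0) (i := (dorder q).-1).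
    rewrite E qq' eqv_conn_lr ?prednK // !eqv_refl qq' r0 r'0 prednK // leqnn /=.
    by rewrite !andbT => ->.
  by case: e {E}; case: e'.
- apply: diagram_ext => // s i t j iq jq.
  by rewrite -(eqv_conn_ll e q0 r0) // E eqv_conn_ll // -qq'.
- apply: diagram_ext => // s i t j iq jq.
  by rewrite -(eqv_conn_rr e q0 r0) // E qq' eqv_conn_rr // -rr'.
Qed.

End Relations.

(** * Factorizations *)

Lemma conn_neq0l e p q : p <> empty_diag -> conn_op e p q <> empty_diag.
Proof.
by move=> /dorder_gt0 p0 /(congr1 dorder); rewrite dorder_conn dorder_empty; lia.
Qed.

Lemma conn_neq0r e p q : q <> empty_diag -> conn_op e p q <> empty_diag.
Proof.
by move=> /dorder_gt0 p0 /(congr1 dorder); rewrite dorder_conn dorder_empty; lia.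
Qed.

Lemma conn_opI e p : injective (conn_op e p).
Proof.
move=> q q' E; have dE : dorder q = dorder q'.
  by move/(congr1 dorder): E; rewrite !dorder_conn => /addnI.
have [p0|p0] := pselect (p = empty_diag); first by rewrite p0 !conn0d in E.
have [q0|q0] := pselect (q = empty_diag).
  by rewrite q0 in dE *; rewrite (dorder_eq0 (esym dE)).
have q'0 : q' <> empty_diag by move=> q'0; apply/q0/dorder_eq0; rewrite dE q'0.
by have [] := conn_op_inj p0 q0 p0 q'0 E.
Qed.

Definition conn_irreducible (e : conn) : diagram -> Prop :=
  match e with Tens => tens_irreducible | Bullet => bullet_irreducible end.

Lemma conn_irreducibleN e p q r : conn_irreducible e p ->
  q <> empty_diag -> r <> empty_diag -> p <> conn_op e q r.
Proof. by case: e => /= ip q0 r0 E; apply: ip; exists q, r. Qed.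

(** The cut after [q] cannot fall inside [a], which is irreducible for the connective [e] at that
    cut; so it falls at the end of [a] or later. *)
Lemma levi_irreducible c a r e q k :
  a <> empty_diag -> conn_irreducible e a -> q <> empty_diag -> k <> empty_diag ->
  conn_op c a r = conn_op e q k ->
  [/\ c = e, a = q & r = k] \/
  exists2 m, m <> empty_diag & q = conn_op c a m /\ r = conn_op e m k.
Proof.
move=> a0 ia q0 k0 E.
have [r0|r0] := pselect (r = empty_diag).
  by rewrite r0 connd0 in E; have := conn_irreducibleN ia q0 k0.
case: (ltngtP (dorder a) (dorder q)) => h.
- by right; apply: (conn_op_levi a0 r0 q0 k0 E h).
- have [m m0 [aE _]] := conn_op_levi q0 k0 a0 r0 (esym E) h.
  by have := conn_irreducibleN ia q0 m0.
- by left; exact: conn_op_inj.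
Qed.

(** A [tens] cut can lie neither inside [a] nor inside [u], and the junction is excluded because the
    diagram determines its connective. *)
Lemma tens_irreducible_bullet a u : a <> empty_diag -> tens_irreducible a ->
  tens_irreducible u -> tens_irreducible (bullet a u).
Proof.
move=> a0 ia iu [q [k [q0 k0 E]]].
have [[]//|[m m0 [_ uE]]] := @levi_irreducible Bullet a u Tens q k a0 ia q0 k0 E.
by have := @conn_irreducibleN Tens _ _ _ iu m0 k0.
Qed.

Lemma tens_head p : p <> empty_diag ->
  exists a r, [/\ p = tens a r, a <> empty_diag & tens_irreducible a].
Proof.
elim: {p}(dorder p).+1 {-2}p (ltnSn (dorder p)) => // n IH p pn p0.
have [ip|] := pselect (tens_irreducible p).
  by exists p, empty_diag; rewrite tensd0.
move=> /contrapT[q [k [q0 k0 E]]].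
have [||a [r [qE a0 ia]]] := IH q => //.
  move: pn; rewrite E [dorder (tens q k)](dorder_conn Tens).
  by have := dorder_gt0 k0; lia.
exists a, (tens r k); split=> //; rewrite E qE.
have [->|r0] := pselect (r = empty_diag); first by rewrite tensd0 tens0d.
exact: (@conn_opA Tens Tens).
Qed.

(** * Letters and mixed factorizations *)

Definition irreducible p :=
  [/\ p <> empty_diag, tens_irreducible p & bullet_irreducible p].

Lemma irreducible_conn a e : irreducible a -> conn_irreducible e a.
Proof. by case: e => -[]. Qed.

(** A lone letter is written [tens a empty_diag]; the last condition excludes [bullet a empty_diag],
    for which the refinement rule of [Bullet] would fail. *)
Lemma irreducible_head p : p <> empty_diag ->
  exists c a r, [/\ p = conn_op c a r, irreducible a & c = Tens \/ r <> empty_diag].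
Proof.
elim: {p}(dorder p).+1 {-2}p (ltnSn (dorder p)) => // n IH p pn p0.
have [ip|] := pselect (irreducible p).
  by exists Tens, p, empty_diag; rewrite connd0; split=> //; left.
move=> nip; have [e [q [k [q0 k0 E]]]] : exists e q k,
    [/\ q <> empty_diag, k <> empty_diag & p = conn_op e q k].
  have [it|/contrapT[q [k [q0 k0 E]]]] := pselect (tens_irreducible p); last first.
    by exists Tens, q, k.
  have [ib|/contrapT[q [k [q0 k0 E]]]] := pselect (bullet_irreducible p); last first.
    by exists Bullet, q, k.
  by case: nip.
have [||c [a [r [qE ia h]]]] := IH q => //.
  by move: pn; rewrite E dorder_conn; have := dorder_gt0 k0; lia.
have [r0|r0] := pselect (r = empty_diag).
  by exists e, a, k; split; [rewrite E qE r0 connd0|done|right].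
exists c, a, (conn_op e r k); split=> //; last by right; exact: conn_neq0l.
by rewrite E qE conn_opA.
Qed.

Lemma tens_factorization0 s : tens_factorization empty_diag s -> s = [::].
Proof.
case: s => // a s [h]; have [a0 _] := h a (mem_head _ _).
by move=> /= /esym; case/(@conn_neq0l Tens).
Qed.

Lemma tens_factorization_cons a p s : a <> empty_diag -> tens_irreducible a ->
  tens_factorization p s -> tens_factorization (tens a p) (a :: s).
Proof.
move=> a0 ia [h ->]; split=> // d; rewrite inE => /orP[/eqP->//|]; exact: h.
Qed.

(** Both [a] and the first entry of [s] are [tens]-irreducible, so neither of the two first cuts can
    precede the other. *)
Lemma tens_factorization_inv a p s : a <> empty_diag -> tens_irreducible a ->
  tens_factorization (tens a p) s ->
  exists2 s', s = a :: s' & tens_factorization p s'.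
Proof.
move=> a0 ia [h E].
case: s h E => [_ /(@conn_neq0l Tens)//|b s h E].
have [b0 ib] := h b (mem_head _ _); move: E => /= E.
have h' d : d \in s -> d <> empty_diag /\ tens_irreducible d.
  by move=> ds; apply: h; rewrite inE ds orbT.
have [s0|s0] := pselect (tens_seq s = empty_diag).
  have [p0|p0] := pselect (p = empty_diag).
    by exists s; [move: E; rewrite p0 s0 !tensd0 => ->|rewrite p0 -s0].
  by rewrite s0 tensd0 in E; case: ib; exists a, p; split.
have [[_ ab pE]|[m m0 [bE _]]] :=
    @levi_irreducible Tens a p Tens b (tens_seq s) a0 ia b0 s0 E.
  by exists s; rewrite ?ab.
by case: ib; exists a, m; split.
Qed.

Lemma tens_factorization_uniq p s s' :
  tens_factorization p s -> tens_factorization p s' -> s' = s.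
Proof.
elim: s p s' => [|a s IH] p s' [h ->]; first exact: tens_factorization0.
have [a0 ia] := h a (mem_head _ _).
move=> /(tens_factorization_inv a0 ia)[t -> ts]; congr cons.
by apply: IH ts; split=> // d ds; apply: h; rewrite inE ds orbT.
Qed.

Lemma tens_factorization_exists p : exists s, tens_factorization p s.
Proof.
elim: {p}(dorder p).+1 {-2}p (ltnSn (dorder p)) => // n IH p pn.
have [->|p0] := pselect (p = empty_diag); first by exists [::].
have [a [r [pE a0 ia]]] := tens_head p0.
have [|s rs] := IH r.
  move: pn; rewrite pE [dorder (tens a r)](dorder_conn Tens).
  by have := dorder_gt0 a0; lia.
by exists (a :: s); rewrite pE; exact: tens_factorization_cons.
Qed.

Lemma mixed_factorization_cons c a r s cs : irreducible a -> r <> empty_diag ->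
  mixed_factorization r s cs ->
  mixed_factorization (conn_op c a r) (a :: s) (c :: cs).
Proof.
move=> ia r0 [h [sE rE]]; split; last first.
  split; last by rewrite rE.
  by rewrite /= sE; case: s {h sE} rE => //= rE; case: r0; rewrite rE; case: cs.
by move=> d; rewrite inE => /orP[/eqP->//|]; exact: h.
Qed.

Lemma mixed_factorization1 a : irreducible a -> mixed_factorization a [:: a] [::].
Proof. by move=> ia; split=> // d; rewrite inE => /eqP->. Qed.

Lemma mixed_factorization_neq0 p s cs :
  mixed_factorization p s cs -> s <> [::] -> p <> empty_diag.
Proof.
case: s => // a s [h [_ ->]] _; have [a0 _ _] := h a (mem_head _ _).
by case: cs => //= c cs; exact: conn_neq0l.
Qed.

Lemma mixed_factorization_inv c a r s cs : irreducible a ->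
  mixed_factorization (conn_op c a r) s cs ->
  (r = empty_diag /\ s = [:: a] /\ cs = [::]) \/
  r <> empty_diag /\
  exists s' cs', [/\ s = a :: s', cs = c :: cs' & mixed_factorization r s' cs'].
Proof.
move=> ia [h [sE E]]; have [a0 _ _] := ia.
case: s h sE E => [_ _ /(conn_neq0l a0)//|b s h].
have h' d : d \in s -> irreducible d by move=> ds; apply: h; rewrite inE ds orbT.
have ib := h b (mem_head _ _); have [b0 _ _] := ib.
case: s h h' => [|d s] h h'; case: cs => [|e cs] // sE.
  move=> /= E; have [r0|r0] := pselect (r = empty_diag).
    by left; rewrite -E r0 connd0.
  by have := conn_irreducibleN (irreducible_conn c ib) a0 r0; rewrite E.
move: sE => [sE] E.
have R : mixed_factorization (mixed_prod (d :: s) cs) (d :: s) cs by [].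
have k0 := mixed_factorization_neq0 R (fun e => ltac:(discriminate e)).
have [[ce ab rk]|[m m0 [bE _]]] :=
    levi_irreducible a0 (irreducible_conn e ia) b0 k0 E.
  by right; rewrite ce ab rk; split=> //; exists (d :: s), cs.
by have := conn_irreducibleN (irreducible_conn c ib) a0 m0.
Qed.

Lemma mixed_factorization_uniq p s cs s' cs' :
  mixed_factorization p s cs -> mixed_factorization p s' cs' ->
  s' = s /\ cs' = cs.
Proof.
elim: s p cs s' cs' => [|a s IH] p cs s' cs' [h [sE pE]].
  have p0 : p = empty_diag by rewrite pE; case: {sE pE} cs.
  move=> R; have s'0 : s' = [::].
    by apply: contrapT => /(mixed_factorization_neq0 R); rewrite p0.
  case: R => _ [+ _]; rewrite s'0 /= => /size0nil->.
  by move: sE => /= /size0nil->.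
have ia : irreducible a := h a (mem_head _ _).
have h' d : d \in s -> irreducible d by move=> ds; apply: h; rewrite inE ds orbT.
case: s IH sE pE h h' => [|b s] IH; case: cs => [|c cs] // sE -> h h' R.
  (* A single letter is written as a product with the empty diagram to make the inversion lemma
     applicable. *)
  by rewrite [mixed_prod _ _](esym (connd0 Tens a)) in R;
    have [[_ []]|[]] := mixed_factorization_inv ia R.
have R0 : mixed_factorization (mixed_prod (b :: s) cs) (b :: s) cs.
  by split=> //; split=> //; case: sE.
have [[r0 _]|[_ [t [ct [-> -> R']]]]] := mixed_factorization_inv ia R.
  by have := mixed_factorization_neq0 R0 (fun e => ltac:(discriminate e)).
by have [-> ->] := IH _ _ _ _ R0 R'.
Qed.

(** * Refinement letter by letter *)

Lemma tens_positionsE p s cs : mixed_factorization p s cs ->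
  forall i, tens_positions p i <->
    (0 < i < size s)%N /\ nth Bullet cs i.-1 = Tens.
Proof.
move=> R i; split; last by case=> hi ni; exists s, cs.
by case=> s' [cs' [/(mixed_factorization_uniq R)[-> ->]]].
Qed.

(** As the default of [nth] is [Bullet], a [Tens] only occurs inside the list, so the bounds on
    positions disappear. *)
Lemma tens_positions_sub p q s cs ds :
  mixed_factorization p s cs -> mixed_factorization q s ds ->
  (tens_positions q `<=` tens_positions p)%classic <->
  (forall i, nth Bullet ds i = Tens -> nth Bullet cs i = Tens).
Proof.
move=> Rp Rq; split=> [H i hi|H i].
  have : tens_positions q i.+1.
    apply/(tens_positionsE Rq); split=> //.
    case: Rq => _ [+ _]; case: (ltnP i (size ds)) => [ids sE|ids].
      by move: ids; rewrite sE; case: (size s).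
    by rewrite nth_default in hi.
  by move/H/(tens_positionsE Rp) => [].
by move=> /(tens_positionsE Rq)[hi /H ni]; apply/(tens_positionsE Rp).
Qed.

Lemma refines_neq0 p q : refines q p -> p <> empty_diag -> q <> empty_diag.
Proof. by case=> [[_ ->]//|[]]. Qed.

Lemma refines0 q : refines q empty_diag <-> q = empty_diag.
Proof. by split=> [[[]|[]]//|->]; left. Qed.

Lemma refines_irreducible q a : irreducible a -> refines q a <-> q = a.
Proof.
move=> ia; have R := mixed_factorization1 ia; have [a0 _ _] := ia; split.
  case=> [[_ a0']//|[q0 _ [s [c [c' [Rq Ra]]]] _]].
  have [sE _] := mixed_factorization_uniq R Ra; rewrite sE in Rq.
  by case: Rq => _ []; case: c.
move=> ->; right; split=> //; by exists [:: a], [::], [::].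
Qed.

(** The connective after the first letter is refined independently of the rest: [Tens] must stay,
    [Bullet] may become either. *)
Lemma refines_conn q c a r : irreducible a -> r <> empty_diag ->
  refines q (conn_op c a r) <->
  exists e r', [/\ q = conn_op e a r', refines r' r & c = Tens -> e = Tens].
Proof.
move=> ia r0; have [a0 _ _] := ia; split.
  case=> [[_ /(conn_neq0l a0)//]|[q0 _ [s [cs [ds [Rq R]]]] S]].
  move/(tens_positions_sub Rq R): S => S.
  have [[]//|[_ [s' [ds' [sE dsE R']]]]] := mixed_factorization_inv ia R.
  have s'0 : s' <> [::].
    move=> s'0; apply: r0; case: R' => _ [_ ->].
    by rewrite s'0; case: (ds').
  rewrite sE in Rq; case: (Rq) => h [].
  case: cs Rq S => [|e cs] Rq S; first by case: (s') s'0.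
  move=> /= [szE] qE; exists e, (mixed_prod s' cs).
  have Rr : mixed_factorization (mixed_prod s' cs) s' cs.
    split; last by split=> //; rewrite -szE.
    by move=> d ds''; apply: h; rewrite inE ds'' orbT.
  split=> //; last by move=> cT; apply: (S 0%N); rewrite dsE.
  right; split=> //; first exact: mixed_factorization_neq0 Rr s'0.
    by exists s', cs, ds'.
  apply/(tens_positions_sub Rr R') => i hi.
  by apply: (S i.+1); rewrite dsE.
move=> [e [r' [-> rr' ce]]]; case: (rr') => [[_ //]|[r'0 _ [s [cs [ds [R' R]]]] S]].
have Rp := mixed_factorization_cons c ia r0 R.
have Rq := mixed_factorization_cons e ia r'0 R'.
right; split; [exact: conn_neq0l|exact: conn_neq0l| |].
  by exists (a :: s), (e :: cs), (c :: ds).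
apply/(tens_positions_sub Rq Rp) => -[|i] //=.
by move/(tens_positions_sub R' R): S => S; exact: S.
Qed.

(** * Refinement sums and quasi-shuffle sums *)

Section RefinementSums.
Import GRing.Theory.
Local Open Scope classical_set_scope.
Variable V : nmodType.
Implicit Types (F G : diagram -> V) (p q r : diagram).

(** With [F] equal to [M K] this is [L K p]. *)
Definition refsum F p : V := \sum_(q \in [set q | refines q p]) F q.

Lemma eq_refsum F G p : (forall q, refines q p -> F q = G q) ->
  refsum F p = refsum G p.
Proof. by move=> FG; apply: eq_fsbigr => q; rewrite inE; exact: FG. Qed.

Lemma refsumD F G p : refsum (fun d => F d + G d) p = refsum F p + refsum G p.
Proof. exact/fsbig_split/finite_refines. Qed.

Lemma refsum_empty F : refsum F empty_diag = F empty_diag.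
Proof.
rewrite /refsum (_ : mkset _ = [set empty_diag]) ?fsbig_set1 //.
by apply/seteqP; split=> q /= /refines0.
Qed.

Lemma refsum_tens F a r : irreducible a ->
  refsum F (tens a r) = refsum (fun d => F (tens a d)) r.
Proof.
move=> ia; rewrite /refsum.
rewrite -(fsbig_image _ (tens a) F); last by move=> x y _ _; exact: (@conn_opI Tens).
apply: eq_fsbigl; apply/seteqP; split=> q /=.
  have [->|r0] := pselect (r = empty_diag).
    rewrite tensd0 => /(refines_irreducible _ ia)->.
    by exists empty_diag; [left|exact: tensd0].
  by case/(@refines_conn _ Tens _ _ ia r0) => e [r' [-> rr' ->//]]; exists r'.
case=> r' rr' <-.
have [r0|r0] := pselect (r = empty_diag).
  move: rr'; rewrite r0 => /= /refines0 ->.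
  by rewrite !tensd0; exact/(refines_irreducible _ ia).
by apply/(@refines_conn _ Tens _ _ ia r0); exists Tens, r'.
Qed.

(** The [Bullet] after [a] stays or becomes [Tens], and the two images are disjoint because the
    connective at a given cut is determined. For empty [r] both terms would count the same
    diagram. *)
Lemma refsum_bullet F a r : irreducible a -> r <> empty_diag ->
  refsum F (bullet a r) =
  refsum (fun d => F (tens a d)) r + refsum (fun d => F (bullet a d)) r.
Proof.
move=> ia r0; have [a0 _ _] := ia; rewrite /refsum.
rewrite -(fsbig_image _ (tens a) F); last by move=> x y _ _; exact: (@conn_opI Tens).
rewrite -(fsbig_image _ (bullet a) F); last by move=> x y _ _;
  exact: (@conn_opI Bullet).
rewrite -fsbigU0; first last.
- move=> _ [[x /refines_neq0 x0 <-] [y /refines_neq0 y0 /= E]].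
  by have [] := @conn_op_inj Bullet Tens _ _ _ _ a0 (y0 r0) a0 (x0 r0) E.
- exact/finite_image/finite_refines.
- exact/finite_image/finite_refines.
apply: eq_fsbigl; apply/seteqP; split=> q /=.
  case/(@refines_conn _ Bullet _ _ ia r0) => -[] [r' [-> rr' _]]; [left|right];
  by exists r'.
case=> -[r' rr' <-]; apply/(@refines_conn _ Bullet _ _ ia r0).
  by exists Tens, r'.
by exists Bullet, r'.
Qed.

End RefinementSums.

(** * Quasi-shuffle sums *)

Section QuasiShuffleSums.
Import GRing.Theory.
Local Open Scope classical_set_scope.

Definition first (s : seq diagram) := head empty_diag s.

(* The quasi-shuffles (or splittings) whose product begins with a label of the
   first argument, respectively of the second. *)
Definition left_first (A : set (seq diagram * seq diagram)) :=
  A `&` [set t | first t.1 <> empty_diag].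
Definition right_first (A : set (seq diagram * seq diagram)) :=
  A `&` ~` [set t | first t.1 <> empty_diag].

Definition zip_tens (t : seq diagram * seq diagram) := tens_seq (bullet_zip t).

Definition push (x y : diagram) (t : seq diagram * seq diagram) :=
  (x :: t.1, y :: t.2).

Lemma push_inj x y : injective (push x y).
Proof. by move=> [s s'] [t t'] [-> ->]. Qed.

Lemma factorization_filter_cons x p s :
  x = empty_diag \/ tens_irreducible x ->
  tens_factorization p [seq d <- s | d != empty_diag] ->
  tens_factorization (tens x p) [seq d <- x :: s | d != empty_diag].
Proof.
move=> ix ps /=; case: eqVneq => [->|/eqP x0]; first by rewrite tens0d.
by case: ix => // ix; exact: tens_factorization_cons.
Qed.

Lemma quasi_shuffles_push x y p q t :
  x = empty_diag \/ tens_irreducible x -> y = empty_diag \/ tens_irreducible y ->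
  x <> empty_diag \/ y <> empty_diag ->
  quasi_shuffles p q t -> quasi_shuffles (tens x p) (tens y q) (push x y t).
Proof.
move=> ix iy xy [st tp tq tn]; split=> /=.
- by rewrite st.
- exact: factorization_filter_cons.
- exact: factorization_filter_cons.
- move=> d; rewrite inE => /orP[/eqP->|]; last exact: tn.
  by case: xy; [exact: (@conn_neq0l Bullet)|exact: (@conn_neq0r Bullet)].
Qed.

(** What remains after the first column is a quasi-shuffle of whichever diagrams its filtered
    sequences factorize, so [p'] and [q'] are left free. *)
Lemma quasi_shuffles_cons p q x y t : quasi_shuffles p q (push x y t) ->
  (forall p' q', tens_factorization p' [seq d <- t.1 | d != empty_diag] ->
    tens_factorization q' [seq d <- t.2 | d != empty_diag] ->
    quasi_shuffles p' q' t) /\ (x <> empty_diag \/ y <> empty_diag).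
Proof.
move=> [[st] tp tq tn]; split=> [p' q' tp' tq'|].
  by split=> // d dt; apply: tn; rewrite inE dt orbT.
have := tn (bullet x y) (mem_head _ _).
by have [->|] := pselect (x = empty_diag); [right|left].
Qed.

(** No column has an empty product, so below an empty left entry stands the first right factor,
    [y]. *)
Lemma right_first_quasi_shuffles p y q : y <> empty_diag -> tens_irreducible y ->
  right_first (quasi_shuffles p (tens y q)) =
  push empty_diag y @` quasi_shuffles p q.
Proof.
move=> y0 iy; apply/seteqP; split=> [[s1 s2] [H /= /contrapT s10]|_ [t H <-]]; last first.
  split; last by move=> /=; apply.
  rewrite -[p]tens0d; apply: quasi_shuffles_push => //; by [left|right].
case: (H) => /= st tp tq _.
case: s2 => [|z s2] in H st tq s10 *.
  by have [] := tens_factorization_inv y0 iy tq.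
case: s1 => // x s1 in H st tp s10 *; rewrite /first /= in s10; subst x.
have [H' [//|z0]] := quasi_shuffles_cons (t := (s1, s2)) H.
move: tq => /=; case: eqVneq => // _ /(tens_factorization_inv y0 iy)[s' [-> E] qs'].
by exists (s1, s2) => //; apply: H' => //=; [move: tp; rewrite /= eqxx|rewrite E].
Qed.

(** The first column pairs [x] either with the empty diagram or with the first right factor [y]. *)
Lemma left_first_quasi_shuffles x p y q :
  x <> empty_diag -> tens_irreducible x -> y <> empty_diag -> tens_irreducible y ->
  left_first (quasi_shuffles (tens x p) (tens y q)) =
  push x empty_diag @` quasi_shuffles p (tens y q) `|`
  push x y @` quasi_shuffles p q.
Proof.
move=> x0 ix y0 iy; apply/seteqP; split=> [[s1 s2] [H /= s10]|t]; last first.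
  case=> -[t' H <-]; split=> //.
    rewrite -[tens y q]tens0d; apply: quasi_shuffles_push => //; by [left|right].
  by apply: quasi_shuffles_push => //; [right|right|left].
case: (H) => /= st tp tq _.
case: s1 => // z s1 in H st tp s10 *; case: s2 => // w s2 in H st tq *.
rewrite /first /= in s10.
have [H' _] := quasi_shuffles_cons (t := (s1, s2)) H.
move: tp => /=; case: eqVneq => // _ /(tens_factorization_inv x0 ix)[s' [-> E] ps'].
move: tq => /=; case: eqVneq => [-> tq|w0]; [left|right].
  by exists (s1, s2) => //; apply: H' => //=; rewrite E.
move: tq => /(tens_factorization_inv y0 iy)[s'' [-> E'] ps''].
by exists (s1, s2) => //; apply: H' => //=; rewrite ?E ?E'.
Qed.

Lemma filter_nil_nseq (s : seq diagram) :
  [seq d <- s | d != empty_diag] = [::] -> s = nseq (size s) empty_diag.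
Proof. by elim: s => //= d s IH; case: eqVneq => // -> /IH <-. Qed.

Lemma bullet_zip_nseq_l (s : seq diagram) :
  bullet_zip (nseq (size s) empty_diag, s) = s.
Proof.
by rewrite /bullet_zip /=; elim: s => //= d s IH; rewrite IH.
Qed.

Lemma bullet_zip_nseq_r (s : seq diagram) :
  bullet_zip (s, nseq (size s) empty_diag) = s.
Proof.
by rewrite /bullet_zip /=; elim: s => //= d s ->; rewrite bulletd0.
Qed.

Lemma filter_nonempty (s : seq diagram) :
  (forall d, d \in s -> d <> empty_diag) -> [seq d <- s | d != empty_diag] = s.
Proof. by move=> h; apply/all_filterP/allP => d /h /eqP. Qed.

Lemma filter_nseq_empty n : [seq d <- nseq n empty_diag | d != empty_diag] = [::].
Proof. by elim: n => //= n ->; rewrite eqxx. Qed.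

(** With nothing on the left, every column needs a non-empty right entry, so the right sequence is
    the factorization itself. *)
Lemma quasi_shuffles_empty_l q s : tens_factorization q s ->
  quasi_shuffles empty_diag q = [set (nseq (size s) empty_diag, s)].
Proof.
move=> qs; have s0 : forall d, d \in s -> d <> empty_diag by move=> d /(qs.1)[].
apply/seteqP; split=>
    [[s1 s2] [/= st /tens_factorization0/filter_nil_nseq s1E tq tn]|_ ->].
  rewrite st in s1E; rewrite s1E bullet_zip_nseq_l in tn.
  rewrite filter_nonempty // in tq.
  by rewrite (tens_factorization_uniq qs tq) in s1E *; rewrite s1E.
by split; rewrite /= ?size_nseq ?filter_nseq_empty ?bullet_zip_nseq_l ?filter_nonempty.
Qed.

Lemma quasi_shuffles_empty_r p s : tens_factorization p s ->
  quasi_shuffles p empty_diag = [set (s, nseq (size s) empty_diag)].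
Proof.
move=> ps; have s0 : forall d, d \in s -> d <> empty_diag by move=> d /(ps.1)[].
apply/seteqP; split=>
    [[s1 s2] [/= st tp /tens_factorization0/filter_nil_nseq s2E tn]|_ ->].
  rewrite -st in s2E; rewrite s2E bullet_zip_nseq_r in tn.
  rewrite filter_nonempty // in tp.
  by rewrite (tens_factorization_uniq ps tp) in s2E *; rewrite s2E.
by split; rewrite /= ?size_nseq ?filter_nseq_empty ?bullet_zip_nseq_r ?filter_nonempty.
Qed.

Variable V : nmodType.
Implicit Types (F G : diagram -> V) (p q r : diagram).

Definition zipsum (A : set (seq diagram * seq diagram)) F : V :=
  \sum_(t \in A) F (zip_tens t).

Lemma zipsum_first A F : finite_set A ->
  zipsum A F = zipsum (left_first A) F + zipsum (right_first A) F.
Proof. by move=> fA; rewrite /zipsum (fsbigID [set t | first t.1 <> empty_diag]). Qed.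

Lemma zipsum_push x y A F :
  zipsum (push x y @` A) F = zipsum A (fun d => F (tens (bullet x y) d)).
Proof.
by rewrite /zipsum fsbig_image // => t t' _ _; exact: push_inj.
Qed.

Definition qsum F p q := zipsum (quasi_shuffles p q) F.
Definition qsum_left F p q := zipsum (left_first (quasi_shuffles p q)) F.
Definition qsum_right F p q := zipsum (right_first (quasi_shuffles p q)) F.

Lemma qsumE F p q : qsum F p q = qsum_left F p q + qsum_right F p q.
Proof. exact/zipsum_first/finite_quasi_shuffles. Qed.

Lemma qsum_empty_l F q : qsum F empty_diag q = F q.
Proof.
have [s qs] := tens_factorization_exists q.
rewrite /qsum (quasi_shuffles_empty_l qs) /zipsum fsbig_set1 /zip_tens.
by rewrite bullet_zip_nseq_l -(proj2 qs).
Qed.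

Lemma qsum_empty_r F p : qsum F p empty_diag = F p.
Proof.
have [s ps] := tens_factorization_exists p.
rewrite /qsum (quasi_shuffles_empty_r ps) /zipsum fsbig_set1 /zip_tens.
by rewrite bullet_zip_nseq_r -(proj2 ps).
Qed.

Lemma zipsum0 A F : A `<=` set0 -> zipsum A F = 0.
Proof. by move=> A0; apply: fsbig1 => t /A0. Qed.

Lemma qsum_left_empty_l F q : qsum_left F empty_diag q = 0.
Proof.
have [s qs] := tens_factorization_exists q; apply: zipsum0 => t [].
rewrite (quasi_shuffles_empty_l qs) => ->; rewrite /= /first.
by case: s {qs} => [|d s] /=; apply.
Qed.

Lemma qsum_right_empty_l F q : qsum_right F empty_diag q = F q.
Proof. by have := qsumE F empty_diag q; rewrite qsum_left_empty_l add0r qsum_empty_l. Qed.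

Lemma qsum_right_empty_r F p : p <> empty_diag -> qsum_right F p empty_diag = 0.
Proof.
move=> p0; have [s ps] := tens_factorization_exists p; apply: zipsum0 => t [].
rewrite (quasi_shuffles_empty_r ps) => -> /contrapT; rewrite /= /first.
case: s ps => [[_ //]|d s [/(_ d (mem_head _ _))[d0 _] _]] /= ed; exact: d0.
Qed.

Lemma qsum_left_empty_r F p : p <> empty_diag -> qsum_left F p empty_diag = F p.
Proof.
by move=> p0; have := qsumE F p empty_diag;
  rewrite qsum_right_empty_r // addr0 qsum_empty_r.
Qed.

Lemma qsum_right_tens F p y q : y <> empty_diag -> tens_irreducible y ->
  qsum_right F p (tens y q) = qsum (fun d => F (tens y d)) p q.
Proof.
by move=> y0 iy; rewrite /qsum_right right_first_quasi_shuffles // zipsum_push.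
Qed.

Lemma qsum_left_tens_tens F x p y q :
  x <> empty_diag -> tens_irreducible x -> y <> empty_diag -> tens_irreducible y ->
  qsum_left F (tens x p) (tens y q) =
  qsum (fun d => F (tens x d)) p (tens y q) +
  qsum (fun d => F (tens (bullet x y) d)) p q.
Proof.
move=> x0 ix y0 iy; rewrite /qsum_left left_first_quasi_shuffles // /zipsum.
rewrite fsbigU0; first last.
- by move=> _ [[t _ <-] [t' _ /(congr1 (fun u => first u.2)) /y0]].
- exact/finite_image/finite_quasi_shuffles.
- exact/finite_image/finite_quasi_shuffles.
by rewrite -!/(zipsum _ _) !zipsum_push bulletd0.
Qed.

Lemma tens_bullet_assoc a y d : y <> empty_diag ->
  tens (bullet a y) d = bullet a (tens y d).
Proof. exact: (@conn_opA Bullet Tens). Qed.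

(** Merging [a] with the first factor [y] of [q] amounts to applying [bullet a] to a product that
    starts with [y], that is, to a right-first one. *)
Lemma qsum_left_tens F a r q : irreducible a -> q <> empty_diag ->
  qsum_left F (tens a r) q =
  qsum (fun d => F (tens a d)) r q + qsum_right (fun d => F (bullet a d)) r q.
Proof.
move=> [a0 ia _] /tens_head[y [v [-> y0 iy]]].
rewrite qsum_left_tens_tens // qsum_right_tens //; congr (_ + _).
by apply: eq_fsbigr => t _; rewrite tens_bullet_assoc.
Qed.

(** If [x] is the first [tens] factor of [r], then [bullet a x] is that of [bullet a r], so [a]
    stays attached to [x] at the front of every product. *)
Lemma qsum_left_bullet F a r q : irreducible a -> r <> empty_diag ->
  q <> empty_diag ->
  qsum_left F (bullet a r) q = qsum_left (fun d => F (bullet a d)) r q.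
Proof.
move=> [a0 ia _] /tens_head[x [u [-> x0 ix]]] /tens_head[y [v [-> y0 iy]]].
rewrite -tens_bullet_assoc //.
rewrite qsum_left_tens_tens //; last first.
- exact: tens_irreducible_bullet.
- exact: (@conn_neq0l Bullet).
rewrite qsum_left_tens_tens //; congr (_ + _); apply: eq_fsbigr => t _.
  by rewrite tens_bullet_assoc.
rewrite -tens_bullet_assoc; last exact: (@conn_neq0l Bullet).
by congr (F (tens _ _)); exact: (@conn_opA Bullet Bullet).
Qed.

Lemma qsum_right_bullet F p b r : irreducible b -> r <> empty_diag ->
  qsum_right F p (bullet b r) = qsum_right (fun d => F (bullet b d)) p r.
Proof.
move=> [b0 ib _] /tens_head[y [v [-> y0 iy]]].
rewrite -tens_bullet_assoc // !qsum_right_tens //; last first.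
- exact: tens_irreducible_bullet.
- exact: (@conn_neq0l Bullet).
by apply: eq_fsbigr => t _; rewrite tens_bullet_assoc.
Qed.

End QuasiShuffleSums.

(** * Splittings *)

Section Splittings.
Local Open Scope classical_set_scope.

Definition expresses (p : diagram) (s : seq diagram) :=
  exists c, mixed_expression p s c.

Lemma expresses_nil p : expresses p [::] -> p = empty_diag.
Proof. by case=> c [_ ->]; case: c. Qed.

Lemma expresses1 p d : expresses p [:: d] <-> p = d.
Proof. by split=> [[c []]|->]; [case: c|exists [::]]. Qed.

Lemma expresses_cons p d s : s <> [::] ->
  expresses p (d :: s) <-> exists e p', p = conn_op e d p' /\ expresses p' s.
Proof.
case: s => // d' s _; split=> [[[|e c] [//= [sc] ->]]|[e [p' [-> [c [sc ->]]]]]].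
  by exists e, (mixed_prod (d' :: s) c); split=> //; exists c.
by exists (e :: c); split=> //=; rewrite sc.
Qed.

Lemma expresses_neq0 p s d :
  expresses p s -> d \in s -> d <> empty_diag -> p <> empty_diag.
Proof.
move=> [c /dorder_mixed_expression dp] ds /dorder_gt0 d0 p0.
by have := mem_sumn_le ds; rewrite -dp p0 dorder_empty; lia.
Qed.

(** This predicate and the next are the last two conditions of [splittings], for a single
    sequence. *)
Definition nonlast_neq0 (s : seq diagram) :=
  forall i, (i < (size s).-1)%N -> nth empty_diag s i <> empty_diag.

Definition tail_neq0 (s : seq diagram) :=
  forall i, (0 < i < size s)%N -> nth empty_diag s i <> empty_diag.

Lemma nonlast_neq0_cons d s : s <> [::] ->
  nonlast_neq0 (d :: s) <-> d <> empty_diag /\ nonlast_neq0 s.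
Proof.
case: s => // e s _; split=> [H|[d0 H] [|i] //=].
  by split=> [|i si]; [exact: (H 0%N)|exact: (H i.+1)].
exact: H.
Qed.

Lemma tail_neq0_cons d s :
  tail_neq0 (d :: s) <-> forall e, e \in s -> e <> empty_diag.
Proof.
split=> [H e /(nthP empty_diag)[i si <-]|H [//|i] /= si]; first exact: (H i.+1).
exact/H/mem_nth.
Qed.

Lemma expresses_tail_neq0 p d s : s <> [::] -> tail_neq0 (d :: s) ->
  expresses p s -> p <> empty_diag.
Proof.
case: s => // e s _ /tail_neq0_cons H /expresses_neq0; apply; first exact: mem_head.
exact/H/mem_head.
Qed.

Lemma tail_neq0S d s : tail_neq0 (d :: s) -> tail_neq0 s.
Proof.
case: s => [|e s]; first by move=> _ i; rewrite ltn0 andbF.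
by move=> /tail_neq0_cons H; apply/tail_neq0_cons => f fs; apply: H; rewrite inE fs orbT.
Qed.

Lemma tail_neq0_head d e s : tail_neq0 (d :: s) -> tail_neq0 (e :: s).
Proof. by move/tail_neq0_cons => H; exact/tail_neq0_cons. Qed.

Lemma dorder_zip_tens p q t : splittings p q t ->
  dorder (zip_tens t) = (dorder p + dorder q)%N.
Proof.
move=> [st [c /dorder_mixed_expression ->] [d /dorder_mixed_expression ->] _ _].
by rewrite dorder_tens_seq sumn_bullet_zip.
Qed.

Lemma zip_tens_neq0 p q t : p <> empty_diag \/ q <> empty_diag ->
  splittings p q t -> zip_tens t <> empty_diag.
Proof.
move=> pq /dorder_zip_tens + t0; rewrite t0 dorder_empty.
by case: pq => /dorder_gt0; lia.
Qed.

(** An expression of the empty diagram has only empty entries, whereas left entries after the first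
    are non-empty; hence there is a single column. *)
Lemma splittings_empty_l q : q <> empty_diag ->
  splittings empty_diag q = [set ([:: empty_diag], [:: q])].
Proof.
move=> q0; apply/seteqP; split=> [[r s]|_ ->]; last first.
  by split=> //=; [exists [::]|exists [::]|case].
case=> /= rs er es _ /= r0.
case: r s rs er es r0 => [|x r] [|y s] //= rs er es r0.
  by case: q0; exact: expresses_nil.
case: r rs er r0 => [|x' r] rs er r0.
  case: s rs es => // _ /expresses1->.
  by move/expresses1: er => <-.
move: er => /expresses_neq0 er; exfalso; apply: (er x') => //.
  by rewrite !inE eqxx orbT.
exact: (r0 1%N).
Qed.

Lemma splittings_empty_r p : p <> empty_diag ->
  splittings p empty_diag = [set ([:: p], [:: empty_diag])].
Proof.
move=> p0; apply/seteqP; split=> [[r s]|_ ->]; last first.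
  by split=> //=; [exists [::]|exists [::]|case=> //; case].
case=> /= rs er es /= s0 _.
case: r s rs er es s0 => [|x r] [|y s] //= rs er es s0.
  by case: p0; exact: expresses_nil.
case: s rs es s0 => [|y' s] rs es s0.
  case: r rs er => // _ /expresses1->.
  by move/expresses1: es => <-.
move: es => /expresses_neq0 es; exfalso; apply: (es y) => //.
  exact: mem_head.
exact: (s0 0%N).
Qed.

(** * Grafting and removing a first letter *)

Definition graft_left c a (t : seq diagram * seq diagram) :=
  (conn_op c a (first t.1) :: behead t.1, t.2).
Definition graft_right c a (t : seq diagram * seq diagram) :=
  (t.1, conn_op c a (first t.2) :: behead t.2).

(** When more entries follow an empty [x], the letter becomes the first entry and [c] the connective
    after it; a non-empty [x] absorbs the letter by associativity. *)
Lemma expresses_graft c a p x s : tail_neq0 (x :: s) ->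
  expresses p (x :: s) -> expresses (conn_op c a p) (conn_op c a x :: s).
Proof.
case: s => [|y s] H; first by move/expresses1->; exact/expresses1.
move/expresses_cons => [//|e [p' [-> ep']]]; apply/expresses_cons => //.
have [->|x0] := pselect (x = empty_diag).
  by exists c, p'; rewrite connd0 conn0d.
by exists e, p'; rewrite conn_opA.
Qed.

(** Deleting [a] from the first left entry undoes the grafting; an entry equal to [a] becomes empty,
    which is allowed in first place. *)
Lemma left_first_splittings c a r q : irreducible a -> q <> empty_diag ->
  left_first (splittings (conn_op c a r) q) = graft_left c a @` splittings r q.
Proof.
move=> ia q0; have [a0 _ _] := ia; apply/seteqP; split; last first.
  move=> _ [[s1 s2] [/= st es1 es2 n2 n1] <-].
  case: s1 st es1 n1 => [|x s1] st es1 n1.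
    by case: s2 st es2 {n2} => // _ /expresses_nil.
  split=> /=; last by rewrite /first /=; exact: conn_neq0l.
  split=> //=; first exact: expresses_graft.
  exact: (@tail_neq0_head x).
move=> [[|h s1] s2] []; rewrite /= /first /=; first by move=> _ [].
case=> /= st es1 es2 n2 n1 h0.
case: s1 => [|k s1] in st es1 n1 *.
  exists ([:: r], s2); last by rewrite /graft_left /=; move/expresses1: es1 => ->.
  by split=> //=; [exact/expresses1|case].
(* Entries after the first are non-empty, hence so is what they express, as the Levi-type lemma
   requires. *)
have k0 p' := @expresses_tail_neq0 p' h (k :: s1) (fun e => ltac:(discriminate e)) n1.
move/expresses_cons: es1 => [//|e [p' [E ep']]].
have [[ce ah rp']|[m m0 [hE rE]]] :=
    levi_irreducible a0 (irreducible_conn e ia) h0 (k0 _ ep') E.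
  exists (empty_diag :: k :: s1, s2); last by rewrite /graft_left /= /first /= connd0 ah.
  split=> //; last exact: (@tail_neq0_head h).
  (* Any connective may follow an empty entry. *)
  by apply/expresses_cons => //; exists Tens, p'; rewrite conn0d.
exists (m :: k :: s1, s2); last by rewrite /graft_left /= /first /= hE.
split=> //; last exact: (@tail_neq0_head h).
by apply/expresses_cons => //; exists e, p'.
Qed.

(** If the first right entry is just [b], deleting it would leave an empty entry before the last
    place, so the whole column goes and the next left entry, which is non-empty, comes first.
    Otherwise a non-empty diagram remains in that entry. *)
Lemma right_first_splittings c b p r : irreducible b -> p <> empty_diag ->
  right_first (splittings p (conn_op c b r)) =
  push empty_diag b @` left_first (splittings p r) `|`
  graft_right c b @` right_first (splittings p r).
Proof.
move=> ib p0; have [b0 _ _] := ib; apply/seteqP; split; last first.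
  move=> t [] [[s1 s2] [[/= st es1 es2 n2 n1] f1] <-].
    case: s1 st es1 n1 f1 => [|x s1] st es1 n1 f1.
      by case: p0; exact: expresses_nil.
    rewrite /= /first /= in f1.
    have s20 : s2 <> [::] by case: s2 st {es2 n2}.
    have n1' : tail_neq0 (empty_diag :: x :: s1).
      apply/tail_neq0_cons => d; rewrite inE => /orP[/eqP->//|].
      by move/tail_neq0_cons: n1; exact.
    have n2' : nonlast_neq0 (b :: s2) by apply/(nonlast_neq0_cons b s20).
    split; last by apply.
    split=> //=.
    + by rewrite -st.
    + by apply/expresses_cons => //; exists Tens, p; rewrite conn0d.
    + by apply/expresses_cons => //; exists c, r.
  move: f1 => /contrapT; rewrite /= /first => f1.
  case: s1 st es1 n1 f1 => [|x s1] st es1 n1 f1.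
    by case: p0; exact: expresses_nil.
  rewrite /= in f1; subst x.
  case: s2 st es2 n2 => // y s2 [st] es2 n2.
  have s10 : s1 <> [::].
    by move=> s10; rewrite s10 in es1; apply: p0; exact/expresses1.
  have s20 : s2 <> [::] by move=> s20; move: st; rewrite s20; case: (s1) s10.
  have [y0 n2'] := (nonlast_neq0_cons y s20).1 n2.
  split; last by apply.
  split=> //=; first by rewrite st.
  + move/(expresses_cons _ _ s20): es2 => [e [p' [-> ep']]].
    by apply/(expresses_cons _ _ s20); exists e, p'; rewrite conn_opA.
  + by apply/(nonlast_neq0_cons _ s20); split=> //; exact: conn_neq0l.
move=> [[|h s1] s2] [[/= st es1 es2 n2 n1]]; rewrite /= /first /= => /contrapT h0.
  by case: p0; exact: expresses_nil.
subst h; case: s2 st es2 n2 => // z s2 [st] es2 n2.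
(* A single column with empty left entry would make [p] empty, so [z] is not the last right
   entry. *)
have s10 : s1 <> [::].
  by move=> s10; rewrite s10 in es1; apply: p0; exact/expresses1.
have s20 : s2 <> [::] by move=> s20; move: st; rewrite s20; case: (s1) s10.
have [z0 n2'] := (nonlast_neq0_cons z s20).1 n2.
have ep : expresses p s1.
  by move/(expresses_cons _ _ s10): es1 => [e [p' [-> ep']]]; rewrite conn0d.
have f1 : first s1 <> empty_diag.
  by case: (s1) s10 n1 => // k s _ n1; apply: (n1 1%N).
move/(expresses_cons _ _ s20): es2 => [e [q' [E eq']]].
have PUSH : z = b -> expresses r s2 ->
    (push empty_diag b @` left_first (splittings p r)) (empty_diag :: s1, z :: s2).
  move=> -> er; exists (s1, s2) => //; split=> //; split=> //.
  exact: tail_neq0S n1.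
have GRAFT m : m <> empty_diag -> z = conn_op c b m -> expresses r (m :: s2) ->
    (graft_right c b @` right_first (splittings p r)) (empty_diag :: s1, z :: s2).
  move=> m0 -> er; exists (empty_diag :: s1, m :: s2) => //; split; last by apply.
  split=> //=; first by rewrite st.
  by apply/(nonlast_neq0_cons _ s20).
(* What follows [z] may be a lone empty entry, a case outside the Levi-type lemma. *)
have [q'0|q'0] := pselect (q' = empty_diag).
  rewrite q'0 connd0 in E eq'.
  have [r0|r0] := pselect (r = empty_diag).
    by left; apply: PUSH; rewrite ?r0 // -E r0 connd0.
  right; apply: (GRAFT r) => //.
  by apply/(expresses_cons _ _ s20); exists Tens, empty_diag; rewrite connd0.
have [[ce bz rq']|[m m0 [zE rE]]] :=
    levi_irreducible b0 (irreducible_conn e ib) z0 q'0 E.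
  by left; apply: PUSH; rewrite ?rq'.
right; apply: (GRAFT m) => //.
by apply/(expresses_cons _ _ s20); exists e, q'.
Qed.

Lemma zip_tens_cons x y r s :
  zip_tens (x :: r, y :: s) = tens (bullet x y) (zip_tens (r, s)).
Proof. by []. Qed.

Lemma zip_tens_graft_left_left c a r q t : left_first (splittings r q) t ->
  zip_tens (graft_left c a t) = conn_op c a (zip_tens t).
Proof.
case: t => [[|x s1] [|y s2]] [[//= st _ _ _ _]]; rewrite /= /first /= => x0 //.
rewrite /graft_left !zip_tens_cons /first /=.
rewrite -(@conn_opA c Tens); last exact: (@conn_neq0l Bullet).
by congr tens; exact: (@conn_opA c Bullet).
Qed.

(** The first left entry is empty, so the grafted letter meets the right entry through the [bullet]
    of its column, and [c] leaves no trace. *)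
Lemma zip_tens_graft_left_right c a r q t : q <> empty_diag ->
  right_first (splittings r q) t ->
  zip_tens (graft_left c a t) = bullet a (zip_tens t).
Proof.
move=> q0; case: t => [[|x s1] [|y s2]] [[//= st _ es2 n2 _]]; rewrite /= /first /=.
  by case: q0; exact: expresses_nil.
move=> /contrapT->; rewrite /graft_left !zip_tens_cons /first /= connd0.
apply: (@conn_opA Bullet Tens).
(* The right entry [y] is non-empty: it is [q] if its column is alone, and it is not last
   otherwise. *)
case: s2 es2 n2 {st} => [/expresses1 <-//|z s2 _ n2].
by have [] := (nonlast_neq0_cons y (s := z :: s2) (fun e => ltac:(discriminate e))).1 n2.
Qed.

Lemma right_first_head_neq0 p r t : p <> empty_diag ->
  right_first (splittings p r) t -> first t.2 <> empty_diag.
Proof.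
move=> p0; case: t => [[|x s1] [|y s2]] [[//= st es1 _ n2 n1]]; rewrite /= /first /=.
  by case: p0; exact: expresses_nil.
move=> /contrapT x0; subst x; move: n2.
case: s2 st => [|z s2] st n2.
  case: s1 st es1 {n1} => // _ /expresses1 pE; by case: p0.
by have [] := (nonlast_neq0_cons y (s := z :: s2) (fun e => ltac:(discriminate e))).1 n2.
Qed.

Lemma zip_tens_graft_right c b p r t : p <> empty_diag ->
  right_first (splittings p r) t ->
  zip_tens (graft_right c b t) = conn_op c b (zip_tens t).
Proof.
move=> p0 H; have := right_first_head_neq0 p0 H.
case: t H => [[|x s1] [|y s2]] [[//= st es1 _ _ _]]; rewrite /= /first /=.
move=> /contrapT-> y0; rewrite /graft_right !zip_tens_cons /first /=.
exact: (@conn_opA c Tens).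
Qed.

(** Restricted because [first] identifies [[::]] with [[:: empty_diag]], and grafting sends both to
    the same list. *)
Lemma graft_left_inj c a : {in [set t | t.1 <> [::]] &, injective (graft_left c a)}.
Proof.
move=> [[|x s1] s2] [[|y r1] r2]; rewrite !inE //= => _ _.
by rewrite /graft_left /first /= => -[/conn_opI -> -> ->].
Qed.

Lemma graft_right_inj c a : {in [set t | t.2 <> [::]] &, injective (graft_right c a)}.
Proof.
move=> [s1 [|x s2]] [r1 [|y r2]]; rewrite !inE //= => _ _.
by rewrite /graft_right /first /= => -[-> /conn_opI -> ->].
Qed.

Lemma splittings_nonnil p q t : p <> empty_diag \/ q <> empty_diag ->
  splittings p q t -> t.1 <> [::] /\ t.2 <> [::].
Proof.
case: t => [[|x s1] [|y s2]] pq [//= st es1 es2 _ _].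
by case: pq => -[]; exact: expresses_nil.
Qed.

End Splittings.

(** * Sums over splittings and the comparison of the recursions *)

Section SplittingSums.
Import GRing.Theory.
Local Open Scope classical_set_scope.
Variable V : nmodType.
Implicit Types (F G : diagram -> V) (p q r : diagram).

Lemma eq_zipsum A F G : (forall t, A t -> F (zip_tens t) = G (zip_tens t)) ->
  zipsum A F = zipsum A G.
Proof. by move=> FG; apply: eq_fsbigr => t; rewrite inE; exact: FG. Qed.

Lemma finite_left_first A : finite_set A -> finite_set (left_first A).
Proof. by apply: sub_finite_set => t []. Qed.

Lemma finite_right_first A : finite_set A -> finite_set (right_first A).
Proof. by apply: sub_finite_set => t []. Qed.

(** The product of a grafted splitting keeps the connective [c] if the splitting was left-first, and
    acquires [bullet] if it was right-first. *)
Lemma zipsum_splittings_left F c a r q : irreducible a -> q <> empty_diag ->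
  zipsum (left_first (splittings (conn_op c a r) q)) F =
  zipsum (left_first (splittings r q)) (fun d => F (conn_op c a d)) +
  zipsum (right_first (splittings r q)) (fun d => F (bullet a d)).
Proof.
move=> ia q0; rewrite left_first_splittings // {1}/zipsum fsbig_image; last first.
  move=> s t; rewrite !inE => Hs Ht; apply: graft_left_inj; rewrite !inE.
    by have [] := splittings_nonnil (or_intror q0) Hs.
  by have [] := splittings_nonnil (or_intror q0) Ht.
rewrite (fsbigID [set t | first t.1 <> empty_diag]); last exact: finite_splittings.
congr (_ + _); apply: eq_fsbigr => t; rewrite inE => Ht; congr F.
  exact: zip_tens_graft_left_left Ht.
exact: zip_tens_graft_left_right Ht.
Qed.

Lemma zipsum_splittings_right F c b p r : irreducible b -> p <> empty_diag ->
  zipsum (right_first (splittings p (conn_op c b r))) F =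
  zipsum (left_first (splittings p r)) (fun d => F (tens b d)) +
  zipsum (right_first (splittings p r)) (fun d => F (conn_op c b d)).
Proof.
move=> ib p0; rewrite right_first_splittings // {1}/zipsum.
rewrite fsbigU0; first last.
(* A pair in both images would present the letter [b] as a product of itself with a non-empty
   diagram. *)
- move=> _ [[t Ht <-] [t' Ht' E]].
  have := right_first_head_neq0 p0 Ht'.
  have [b0 _ _] := ib; have := congr1 (fun u => first u.2) E.
  rewrite /= /first /= => bE m0.
  have := conn_irreducibleN (irreducible_conn c ib) b0 m0; rewrite bE; exact.
- exact/finite_image/finite_right_first/finite_splittings.
- exact/finite_image/finite_left_first/finite_splittings.
congr (_ + _); first exact: zipsum_push.
rewrite fsbig_image; last first.
  move=> s t; rewrite !inE => -[Hs _] [Ht _]; apply: graft_right_inj; rewrite !inE.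
    by have [] := splittings_nonnil (or_introl p0) Hs.
  by have [] := splittings_nonnil (or_introl p0) Ht.
by apply: eq_fsbigr => t; rewrite inE => Ht; rewrite (zip_tens_graft_right _ _ p0 Ht).
Qed.

Lemma zipsum_refsum_tens F a A : irreducible a ->
  zipsum A (fun d => refsum F (tens a d)) =
  zipsum A (refsum (fun d => F (tens a d))).
Proof. by move=> ia; apply: eq_zipsum => t _; exact: refsum_tens. Qed.

Lemma zipsum_refsum_bullet F a A : irreducible a -> finite_set A ->
  (forall t, A t -> zip_tens t <> empty_diag) ->
  zipsum A (fun d => refsum F (bullet a d)) =
  zipsum A (refsum (fun d => F (tens a d))) +
  zipsum A (refsum (fun d => F (bullet a d))).
Proof.
move=> ia fA A0; rewrite -fsbig_split //; apply: eq_fsbigr => t.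
by rewrite inE => At; apply: refsum_bullet => //; exact: A0.
Qed.

(** With [S] equal to [qsum (M K)] this is the product of [L K p] and [L K q]. *)
Definition refsum2 (S : diagram -> diagram -> V) p q :=
  refsum (fun p' => refsum (S p') q) p.

Lemma eq_refsum2 S T p q :
  (forall p' q', refines p' p -> refines q' q -> S p' q' = T p' q') ->
  refsum2 S p q = refsum2 T p q.
Proof.
by move=> ST; apply: eq_refsum => p' hp; apply: eq_refsum => q' hq; exact: ST.
Qed.

Lemma refsum2D S T p q : refsum2 (fun p' q' => S p' q' + T p' q') p q =
  refsum2 S p q + refsum2 T p q.
Proof. by rewrite -refsumD; apply: eq_refsum => p' _; exact: refsumD. Qed.

Lemma refsum2_tens_l S a r q : irreducible a ->
  refsum2 S (tens a r) q = refsum2 (fun p' => S (tens a p')) r q.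
Proof. exact: refsum_tens. Qed.

Lemma refsum2_bullet_l S a r q : irreducible a -> r <> empty_diag ->
  refsum2 S (bullet a r) q =
  refsum2 (fun p' => S (tens a p')) r q + refsum2 (fun p' => S (bullet a p')) r q.
Proof. exact: refsum_bullet. Qed.

Lemma refsum2_tens_r S p b r : irreducible b ->
  refsum2 S p (tens b r) = refsum2 (fun p' q' => S p' (tens b q')) p r.
Proof. by move=> ib; apply: eq_refsum => p' _; exact: refsum_tens. Qed.

Lemma refsum2_bullet_r S p b r : irreducible b -> r <> empty_diag ->
  refsum2 S p (bullet b r) =
  refsum2 (fun p' q' => S p' (tens b q')) p r +
  refsum2 (fun p' q' => S p' (bullet b q')) p r.
Proof.
by move=> ib r0; rewrite -refsumD; apply: eq_refsum => p' _; exact: refsum_bullet.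
Qed.

Lemma refsum2_empty_l S q : refsum2 S empty_diag q = refsum (S empty_diag) q.
Proof. exact: refsum_empty. Qed.

Lemma refsum2_empty_r S p : refsum2 S p empty_diag = refsum (S^~ empty_diag) p.
Proof. by apply: eq_refsum => p' _; exact: refsum_empty. Qed.

Lemma refsum2_qsum F p q : refsum2 (qsum F) p q =
  refsum2 (qsum_left F) p q + refsum2 (qsum_right F) p q.
Proof. by rewrite -refsum2D; apply: eq_refsum2 => p' q' _ _; exact: qsumE. Qed.

Lemma refsum2_left_tens F a r q : irreducible a -> q <> empty_diag ->
  refsum2 (qsum_left F) (tens a r) q =
  refsum2 (qsum (fun d => F (tens a d))) r q +
  refsum2 (qsum_right (fun d => F (bullet a d))) r q.
Proof.
move=> ia q0; rewrite refsum2_tens_l // -refsum2D; apply: eq_refsum2 => p' q' _ hq.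
by apply: qsum_left_tens => //; exact: refines_neq0 q0.
Qed.

(** Refinements with [Tens] after [a] contribute [tens a] on full products and [bullet a] on
    right-first ones; those with [Bullet] add [bullet a] on left-first ones, which completes the
    second sum. *)
Lemma refsum2_left_bullet F a r q :
  irreducible a -> r <> empty_diag -> q <> empty_diag ->
  refsum2 (qsum_left F) (bullet a r) q =
  refsum2 (qsum (fun d => F (tens a d))) r q +
  refsum2 (qsum (fun d => F (bullet a d))) r q.
Proof.
move=> ia r0 q0; rewrite refsum2_bullet_l // -refsum2_tens_l //.
rewrite refsum2_left_tens // -addrA; congr (_ + _).
rewrite refsum2_qsum addrC; congr (_ + _); apply: eq_refsum2 => p' q' hp hq.
by apply: qsum_left_bullet => //; [exact: refines_neq0 r0|exact: refines_neq0 q0].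
Qed.

Lemma refsum2_right_tens F p b r : irreducible b ->
  refsum2 (qsum_right F) p (tens b r) = refsum2 (qsum (fun d => F (tens b d))) p r.
Proof.
move=> ib; rewrite refsum2_tens_r //; apply: eq_refsum2 => p' q' _ _.
by have [b0 itb _] := ib; exact: qsum_right_tens.
Qed.

Lemma refsum2_right_bullet F p b r : irreducible b -> r <> empty_diag ->
  refsum2 (qsum_right F) p (bullet b r) =
  refsum2 (qsum (fun d => F (tens b d))) p r +
  refsum2 (qsum_right (fun d => F (bullet b d))) p r.
Proof.
move=> ib r0; rewrite refsum2_bullet_r // -refsum2_tens_r //.
rewrite refsum2_right_tens //; congr (_ + _); apply: eq_refsum2 => p' q' _ hq.
by apply: qsum_right_bullet => //; exact: refines_neq0 r0.
Qed.

(** Induction on the total order, for all [F] at once since removing a letter alters [F]. The two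
    halves go together because the recursions mix them. *)
Lemma refsum2_qsum_splittings_lr F p q : p <> empty_diag \/ q <> empty_diag ->
  refsum2 (qsum_left F) p q = zipsum (left_first (splittings p q)) (refsum F) /\
  refsum2 (qsum_right F) p q = zipsum (right_first (splittings p q)) (refsum F).
Proof.
have [n pqn] := ubnP (dorder p + dorder q).
elim: n => // n IH in p q F pqn *.
have [->|p0 _] := pselect (p = empty_diag).
  case=> // q0; rewrite !refsum2_empty_l splittings_empty_l //; split.
    rewrite zipsum0; first by apply: fsbig1 => q' _; exact: qsum_left_empty_l.
    by move=> t [->]; apply.
  rewrite [RHS]/zipsum (_ : right_first _ = [set ([:: empty_diag], [:: q])]).
    rewrite fsbig_set1 [zip_tens _]tensd0 bullet0d.
    by apply: eq_refsum => q' _; exact: qsum_right_empty_l.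
  by apply/seteqP; split=> [t []//|_ ->]; split=> //; apply.
have [->|q0] := pselect (q = empty_diag).
  rewrite !refsum2_empty_r splittings_empty_r //; split; last first.
    rewrite zipsum0; last by move=> t [-> /contrapT].
    apply: fsbig1 => p' hp; apply: qsum_right_empty_r.
    exact: refines_neq0 hp p0.
  rewrite [RHS]/zipsum (_ : left_first _ = [set ([:: p], [:: empty_diag])]).
    rewrite fsbig_set1 [zip_tens _]tensd0 bulletd0.
    by apply: eq_refsum => p' hp; apply: qsum_left_empty_r; exact: refines_neq0 p0.
  by apply/seteqP; split=> [t []//|_ ->]; split.
have fin_l r s := finite_left_first (finite_splittings r s).
have fin_r r s := finite_right_first (finite_splittings r s).
(* The left-first half removes the first letter of [p], the right-first half that of [q]. *)
split.
  have [c [a [r [pE ia h]]]] := irreducible_head p0.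
  have rqn : (dorder r + dorder q < n)%N.
    by move: pqn; rewrite pE dorder_conn; have [/dorder_gt0 a0 _ _] := ia; lia.
  have rq0 : r <> empty_diag \/ q <> empty_diag by right.
  have IH' G := IH r q G rqn rq0.
  have Z t : left_first (splittings r q) t -> zip_tens t <> empty_diag.
    by case=> /(zip_tens_neq0 rq0).
  have Z' t : right_first (splittings r q) t -> zip_tens t <> empty_diag.
    by case=> /(zip_tens_neq0 rq0).
  rewrite pE zipsum_splittings_left // (zipsum_refsum_bullet _ ia (fin_r _ _) Z').
  case: c h {pE} => /= h.
    rewrite refsum2_left_tens // zipsum_refsum_tens // refsum2_qsum.
    by rewrite !(IH' _).1 !(IH' _).2 addrA.
  have r0 : r <> empty_diag by case: h.
  rewrite refsum2_left_bullet // (zipsum_refsum_bullet _ ia (fin_l _ _) Z).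
  (* Both sides consist of the same four sums, left-first and right-first, with [tens a] and with
     [bullet a], grouped differently. *)
  by rewrite !refsum2_qsum !(IH' _).1 !(IH' _).2 addrACA.
have [c [b [r [qE ib h]]]] := irreducible_head q0.
have prn : (dorder p + dorder r < n)%N.
  by move: pqn; rewrite qE dorder_conn; have [/dorder_gt0 b0 _ _] := ib; lia.
have pr0 : p <> empty_diag \/ r <> empty_diag by left.
have IH' G := IH p r G prn pr0.
have Z' t : right_first (splittings p r) t -> zip_tens t <> empty_diag.
  by case=> /(zip_tens_neq0 pr0).
rewrite qE zipsum_splittings_right // zipsum_refsum_tens //.
case: c h {qE} => /= h.
  rewrite refsum2_right_tens // zipsum_refsum_tens // refsum2_qsum.
  by rewrite !(IH' _).1 !(IH' _).2.
have r0 : r <> empty_diag by case: h.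
rewrite refsum2_right_bullet // (zipsum_refsum_bullet _ ib (fin_r _ _) Z').
by rewrite refsum2_qsum !(IH' _).1 !(IH' _).2 addrA.
Qed.

Lemma refsum2_qsum_splittings F p q : p <> empty_diag \/ q <> empty_diag ->
  refsum2 (qsum F) p q = zipsum (splittings p q) (refsum F).
Proof.
move=> pq; have [Hl Hr] := refsum2_qsum_splittings_lr F pq.
by rewrite refsum2_qsum Hl Hr -zipsum_first //; exact: finite_splittings.
Qed.

End SplittingSums.

(** * Products of the elements [L K p] *)

Section Products.
Import GRing.Theory.
Variable K : fieldType.

(** The unit cases of [starM] agree with the general sum, which then has a single term. *)
Lemma starM_qsum p q : starM K p q = qsum (M K) p q.
Proof.
rewrite /starM; case: eqVneq => [->|_]; first by rewrite qsum_empty_l.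
by case: eqVneq => [->|_]; first by rewrite qsum_empty_r.
Qed.

Let refs p := fset_set [set q | refines q p]%classic.

Lemma refsum_fset (V : nmodType) (F : diagram -> V) p :
  refsum F p = \sum_(q <- refs p) F q.
Proof. exact/fsbig_finite/finite_refines. Qed.

Lemma mcoeff_L p d : (L K p)@_d = (d \in refs p)%:R.
Proof.
rewrite [L K p](refsum_fset (M K) p) raddf_sum /=.
rewrite (eq_bigr (fun q => (q == d)%:R)); last by move=> q _; exact: mcoeffU.
have [dp|dp] := boolP (d \in refs p).
  by rewrite (big_fsetD1 d) //= eqxx big1_fset ?addr0 // => q;
    rewrite !inE => /andP[/negbTE->].
by rewrite big1_fset // => q qp _; case: eqVneq => // qd; rewrite qd (negbTE dp) in qp.
Qed.

Lemma msupp_L p : msupp (L K p) = refs p.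
Proof.
apply/fsetP => d; rewrite -mcoeff_neq0 mcoeff_L.
by case: (d \in _); rewrite ?oner_eq0 ?eqxx.
Qed.

(** The sums in [star] run over supports, and the support of [L K p] is the set of refinements of
    [p], with all coefficients 1. *)
Lemma star_L p q : star (L K p) (L K q) = refsum2 (qsum (M K)) p q.
Proof.
rewrite /star !msupp_L /refsum2 refsum_fset; apply: eq_big_seq => p' hp.
rewrite refsum_fset; apply: eq_big_seq => q' hq.
by rewrite !mcoeff_L hp hq mulr1 scale1r starM_qsum.
Qed.

End Products.

Theorem proposition4p5 (K : fieldType) :
  (forall p q : diagram, p <> empty_diag -> q <> empty_diag ->
     star (L K p) (L K q) =
     \sum_(t \in splittings p q) L K (tens_seq (bullet_zip t)))
  /\
  (forall p : diagram,
     star (L K p) (L K empty_diag) = L K p /\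
     star (L K empty_diag) (L K p) = L K p).
Proof.
split=> [p q p0 _|p].
  by rewrite star_L; apply: refsum2_qsum_splittings; left.
(* The empty diagram refines only itself, so one of the two summations collapses. *)
rewrite !star_L refsum2_empty_l refsum2_empty_r; split; apply: eq_refsum => q _.
  exact: qsum_empty_r.
exact: qsum_empty_l.
Qed.
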